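(* The action $\sharp:G_-^m\times G_+\to G_+$ (respectively $G_-^m\times\hat G_+\to\hat G_+$) is globally defined, where $g\sharp f=\tilde f$ is such that $\tilde f^{-1}gf\in G_-^m$. That is, for every $g\in G_-^m$ and every $f\in G_+$ (respectively $f\in\hat G_+$) there is $\tilde f\in G_+$ (respectively $\tilde f\in\hat G_+$) with $\tilde f^{-1}gf\in G_-^m$, and $g\sharp f=\tilde f$ defines an action.
   Context: A $GL(n,\mathbb C)$-valued map $f(\lambda)$ satisfies the $U(n)$-reality condition if $f(\bar\lambda)^*f(\lambda)=I$. $G_+$ is the group (under pointwise multiplication) of holomorphic maps $f:\mathbb C\to GL(n,\mathbb C)$ satisfying the $U(n)$-reality condition; $\hat G_+$ is the group of holomorphic maps $f:\mathbb C\setminus\{0\}\to GL(n,\mathbb C)$ satisfying it. $G_-^m$ is the group of rational maps $g:S^2=\mathbb C\cup\{\infty\}\to GL(n,\mathbb C)$ (i.e. matrices of rational functions, invertible off a finite set) with $g(\infty)=I$ that satisfy the $U(n)$-reality condition. *)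

(* Defs.v *)
From mathcomp Require Import all_boot all_order all_algebra fraction spectral.
From mathcomp Require Import boolp classical_sets cardinality reals.
From mathcomp Require Import topology normedtype derive.
From mathcomp.real_closed Require Import complex.

Set Implicit Arguments.
Unset Strict Implicit.
Unset Printing Implicit Defensive.

Import Order.TTheory GRing.Theory Num.Theory.
Import numFieldNormedType.Exports.

Local Open Scope classical_set_scope.
Local Open Scope ring_scope.
Local Open Scope sesquilinear_scope.

(* The field C is kept abstract here and is instantiated by R[i], R a         *)
(* realType, in the theorem: the topology and the derivative on a             *)
(* numClosedFieldType are those given by its norm.                            *)

(* The field of rational functions C(lambda).                                 *)
Notation ratfun C := {fraction {poly C}}.
Local Notation "p %:F" := (FracField.tofrac p).

(* The Riemann sphere; None is the point at infinity.                         *)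
Notation sphere C := (option C).

(* x takes the finite value c at the point s of the sphere. The relation is   *)
(* functional in c, and no c is related to a pole s of x. At infinity, the    *)
(* quotient p / q with q != 0 has a finite value iff deg p <= deg q, and the  *)
(* value is then the ratio of the coefficients of degree deg q.               *)
Definition ratval (C : numClosedFieldType) (x : ratfun C) (s : sphere C)
    (c : C) : Prop :=
  exists p q : {poly C}, x = p%:F / q%:F /\
    match s with
    | Some z => q.[z] != 0 /\ c = p.[z] / q.[z]
    | None => [/\ q != 0, (size p <= size q)%N
                & c = p`_(size q).-1 / lead_coef q]
    end.

Definition mxratval (C : numClosedFieldType) (n : nat) (g : 'M[ratfun C]_n)
    (s : sphere C) (A : 'M[C]_n) : Prop :=
  forall i j, ratval (g i j) s (A i j).

Definition holomorphic_on (C : numClosedFieldType) (n : nat) (D : set C)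
    (f : C -> 'M[C]_n) : Prop :=
  forall i j z, D z -> derivable (fun w : C => f w i j) z 1.

(* G_+ is Gplus setT and \hat G_+ is Gplus [set~ 0]. The values of f outside  *)
(* D are irrelevant: maps are identified when they agree on D.                *)
Definition Gplus (C : numClosedFieldType) (n : nat) (D : set C)
    (f : C -> 'M[C]_n) : Prop :=
  [/\ holomorphic_on D f,
      forall z, D z -> f z \in unitmx
    & forall z, D z -> D z^* -> (f z^*)^t* *m f z = 1%:M].

Definition Gminus (C : numClosedFieldType) (n : nat) (g : 'M[ratfun C]_n)
    : Prop :=
  [/\ finite_set [set s : sphere C |
                   ~ exists2 A, mxratval g s A & A \in unitmx],
      mxratval g None 1%:M
    & forall (z : C) (A B : 'M[C]_n),
        mxratval g (Some z) A -> mxratval g (Some z^*) B -> B^t* *m A = 1%:M].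

(* f'^-1 g f is in Gminus: on D, away from the poles, this product coincides  *)
(* with some h in Gminus.                                                     *)
Definition dressing (C : numClosedFieldType) (n : nat) (D : set C)
    (g : 'M[ratfun C]_n) (f f' : C -> 'M[C]_n) : Prop :=
  exists2 h, Gminus h &
    forall (z : C) (A B : 'M[C]_n), D z ->
      mxratval g (Some z) A -> mxratval h (Some z) B ->
      invmx (f' z) *m A *m f z = B.

(* sharp is globally defined on Gminus x Gplus D by the dressing condition,   *)
(* which determines its values, and it is a left action of the group Gminus   *)
(* (whose law is the product of matrices of rational functions).              *)
Definition dressing_action (C : numClosedFieldType) (n : nat) (D : set C)
    (sharp : 'M[ratfun C]_n -> (C -> 'M[C]_n) -> (C -> 'M[C]_n)) : Prop :=
  [/\ forall g f, Gminus g -> Gplus D f ->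
        Gplus D (sharp g f) /\ dressing D g f (sharp g f),
      forall g f f', Gminus g -> Gplus D f ->
        Gplus D f' -> dressing D g f f' ->
        forall z, D z -> f' z = sharp g f z,
      forall f, Gplus D f -> forall z, D z -> sharp 1%:M f z = f z
    & forall g h f, Gminus g -> Gminus h -> Gplus D f ->
        forall z, D z -> sharp (g *m h) f z = sharp g (sharp h f) z].

(* Main.v *)
Require Import Defs.
From HB Require Import structures.
From mathcomp Require Import all_boot all_order all_algebra fraction spectral.
From mathcomp Require Import boolp classical_sets cardinality reals.
From mathcomp Require Import topology normedtype derive.
From mathcomp Require Import constructive_ereal ereal trigo measure.
From mathcomp Require Import lebesgue_measure lebesgue_integral ftc.
From mathcomp.real_closed Require Import complex.
From mathcomp Require Import ring lra.

Set Implicit Arguments.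
Unset Strict Implicit.
Unset Printing Implicit Defensive.

Import Order.TTheory GRing.Theory Num.Theory.
Import numFieldNormedType.Exports.

Local Open Scope classical_set_scope.
Local Open Scope ring_scope.

(** Dressing amounts to a factorization: given g and f, one looks for a rational
h in G_- such that f' = g f h^-1 has no pole in the domain D of f; the reality
condition then makes f' invertible.  Let q be a polynomial such that G = q g f
is holomorphic on D.  Reality of g and f gives
G(z) G(conj z)^* = q(z) conj(q(conj z)) I, and this identity lets one remove the
roots of q one at a time ([factorization]).  For a root a, let P be the orthogonal
projection onto the image of G(a)^*.  Then G(a) (I - P) = 0, and the identity at
conj a gives G(conj a) P = 0.  Hence if s(z) = (I - P) + (z - a) / (z - conj a) P,
which is an element of G_-, then G s is holomorphic on D and vanishes at a, so
that G s = (z - a) G1 with G1 holomorphic and satisfying the same identity for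
q / (z - a).  When no root is left, G is f' itself, and h is a product of
inverses of the elements s.

Uniqueness ([dressing_unique]): if f1 and f2 both solve the problem, with h1 and
h2, then f2^-1 f1 = h2 h1^-1 is a matrix of rational functions that agrees with a
holomorphic one on D.  A point outside D is real and a limit of points of the
real axis in D, and on the real axis f2^-1 f1 is unitary, hence bounded.  So
there is no pole at all, and a rational function without poles that takes a value
at infinity is constant; here this value is I.  The laws of an action follow from
uniqueness, because dressings compose ([dressing_comp]).

Holomorphic means complex differentiable at each point, and dividing G s by z - a
requires that (f(z) - f(a)) / (z - a) be differentiable at a when f is
differentiable near a ([removable_singularity]).  This is reached without power
series.  Goursat's bisection argument, carried out on rectangles of polar
coordinates, shows that the mean of (f(z) - f(z0)) / (z - z0) over a circle
around z0 does not depend on the radius, whence a Cauchy estimate for f'(z0).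
Applied to increments f(z + h) - f(z) and then to increments of increments, the
estimate controls second differences of f, which are symmetric in the two
increments; this symmetry forces the quotients (f'(z0 + h) - f'(z0)) / h to
satisfy the Cauchy criterion as h tends to 0. *)

(** * Derivatives of scalar functions *)

Section Derivable.
Variable C : numClosedFieldType.
Implicit Types (f g : C -> C) (z : C).
Lemma derivable_mul f g z : derivable f z 1 -> derivable g z 1 -> derivable (fun w => f w * g w) z 1.
Proof. exact: (@derivableM C C f g z 1). Qed.
Lemma derivable_add f g z : derivable f z 1 -> derivable g z 1 -> derivable (fun w => f w + g w) z 1.
Proof. exact: (@derivableD C C C f g z 1). Qed.
Lemma derivable_sub f g z : derivable f z 1 -> derivable g z 1 -> derivable (fun w => f w - g w) z 1.
Proof. exact: (@derivableB C C C f g z 1). Qed.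
Lemma derivable_inv f z : f z != 0 -> derivable f z 1 -> derivable (fun w => (f w)^-1) z 1.
Proof. exact: (@derivableV C C f z 1). Qed.
Lemma derivable_const c z : derivable (fun=> c : C) z 1.
Proof. exact: (@derivable_cst C C C c z 1). Qed.
Lemma derivable_var z : derivable (fun w : C => w) z 1.
Proof. exact: (@derivable_id C C z 1). Qed.
Lemma derivable_bigsum n (F : 'I_n -> C -> C) z : (forall i, derivable (F i) z 1) ->
   derivable (fun w => \sum_i F i w) z 1.
Proof.
elim: n F => [|n IH] F H.
  rewrite (_ : (fun w => _) = fun=> 0); first exact: derivable_const.
  by apply/funext => w; rewrite big_ord0.
rewrite (_ : (fun w => _) = fun w => F ord0 w + \sum_i F (lift ord0 i) w).
  by apply: derivable_add => //; apply: IH.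
by apply/funext => w; rewrite big_ord_recl.
Qed.
Lemma is_derive_mul f g z l m : is_derive z 1 f l -> is_derive z 1 g m ->
  is_derive z 1 (fun w => f w * g w) (f z * m + g z * l).
Proof. move=> h1 h2;  exact: (@is_deriveM C C f g z 1 l m). Qed.
Lemma is_derive_sub f g z l m : is_derive z 1 f l -> is_derive z 1 g m ->
  is_derive z 1 (fun w => f w - g w) (l - m).
Proof. move=> h1 h2;  exact: (@is_deriveB C C C f g z 1 l m). Qed.
End Derivable.

(** * Complex numbers over a realType *)

(** An alias of R[i] whose carrier is that of an abstract numClosedFieldType: this
is what lets the topology and the derivatives be inferred. *)
Definition CC (R : realType) : numClosedFieldType := R[i].

Section Modulus.
Variable R : realType.
Implicit Types z w : CC R.

Definition toC (x : R) : CC R := x%:C%C.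
Definition imagC : CC R := 'i%C.
Definition ReC z : R := complex.Re z.
Definition ImC z : R := complex.Im z.
Definition cmod z : R := Normc.normc z.

Fact toC_is_zmod_morphism : zmod_morphism toC. Proof. exact: (rmorphB (real_complex R)). Qed.
Fact toC_is_monoid_morphism : monoid_morphism toC.
Proof. exact: (conj (rmorph1 (real_complex R)) (rmorphM (real_complex R))). Qed.
HB.instance Definition _ := GRing.isZmodMorphism.Build R (CC R) toC toC_is_zmod_morphism.
HB.instance Definition _ :=
  GRing.isMonoidMorphism.Build R (CC R) toC toC_is_monoid_morphism.

Lemma CC_normE z : `|z| = toC (cmod z). Proof. by []. Qed.
Lemma toC_le (x y : R) : (toC x <= toC y) = (x <= y). Proof. exact: lecR. Qed.
Lemma toC_lt (x y : R) : (toC x < toC y) = (x < y). Proof. exact: ltcR. Qed.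
Lemma toC_inj : injective toC. Proof. exact: complexI. Qed.
Lemma CC_gt0P z : 0 < z -> exists2 e : R, 0 < e & z = toC e.
Proof.
case: z => a b; rewrite ltcE /= => /andP[/eqP-> a0]; by exists a.
Qed.

Lemma cmod_ge0 z : 0 <= cmod z. Proof. by case: z => a b; apply: sqrtr_ge0. Qed.
Lemma cmodD z w : cmod (z + w) <= cmod z + cmod w.
Proof. exact: (@le_normcD R). Qed.
Lemma cmodN z : cmod (- z) = cmod z. Proof. exact: (@normcN R). Qed.
Lemma cmodB z w : cmod (z - w) = cmod (w - z). Proof. by rewrite -cmodN opprB. Qed.
Lemma ler_cmodB z w : cmod (z - w) <= cmod z + cmod w.
Proof. by rewrite -(cmodN w); exact: cmodD. Qed.
Lemma cmodM z w : cmod (z * w) = cmod z * cmod w.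
Proof. exact: Normc.normcM. Qed.
Lemma cmodV z : cmod (z^-1) = (cmod z)^-1.
Proof. exact: Normc.normcV. Qed.
Lemma cmod0 : cmod 0 = 0. Proof. exact: Normc.normc0. Qed.
Lemma cmod_toC (x : R) : cmod (toC x) = `|x|.
Proof. by rewrite /cmod /= expr0n /= addr0 sqrtr_sqr. Qed.
Lemma cmod_gt0 z : (0 < cmod z) = (z != 0).
Proof.
rewrite lt_def cmod_ge0 andbT; congr (~~ _); apply/eqP/eqP => [|->].
  exact: Normc.eq0_normc.
exact: cmod0.
Qed.
Lemma cmod_eq0 z : (cmod z == 0) = (z == 0).
Proof. by apply: negb_inj; rewrite -cmod_gt0 lt_def cmod_ge0 andbT. Qed.
Lemma cmod_imagC : cmod imagC = 1.
Proof. by rewrite /cmod /= expr0n expr1n add0r sqrtr1. Qed.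
Lemma cmod_geRe z : `|ReC z| <= cmod z.
Proof. by have := normc_ge_Re z; rewrite lecR. Qed.
Lemma cmod_geIm z : `|ImC z| <= cmod z.
Proof.
case: z => a b; rewrite /cmod /ImC /= -[leLHS]sqrtr_sqr.
by rewrite ler_sqrt ?lerDr ?addr_ge0 ?sqr_ge0.
Qed.
Lemma CC_ReIm z : z = toC (ReC z) + imagC * toC (ImC z).
Proof. exact: complexE. Qed.
Lemma ReB z w : ReC (z - w) = ReC z - ReC w.
Proof. by case: z w => a b [c d]. Qed.
Lemma ImB z w : ImC (z - w) = ImC z - ImC w.
Proof. by case: z w => a b [c d]. Qed.

(** The derivative in terms of the real-valued modulus, so that estimates take place
in the ordered field R rather than in the partially ordered field of complex
numbers. *)
Definition diff_at (f : CC R -> CC R) z l := forall e : R, 0 < e ->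
  exists2 d : R, 0 < d & forall w, cmod (w - z) < d ->
    cmod (f w - f z - l * (w - z)) <= e * cmod (w - z).

Lemma diff_atP (f : CC R -> CC R) (z l : CC R) : diff_at f z l <-> is_derive z 1 f l.
Proof.
have E : (((fun h => h^-1 *: ((f \o shift z) (h *: 1) - f z)) @ (0 : CC R)^') --> l)
     <-> diff_at f z l.
  split.
    move=> /cvgrPdist_le H e e0.
    have /H : 0 < toC e by rewrite toC_lt.
    rewrite /dnbhs /= => /nbhs_ballP [d /= d0 dH].
    have [d' d'0 d'E] := CC_gt0P d0.
    exists d' => // w wd.
    have [->|wz] := eqVneq w z; first by rewrite !subrr mulr0 subr0 cmod0 mulr0.
    have wz0 : w - z != 0 by rewrite subr_eq0.
    have := dH (w - z).
    rewrite /ball /= sub0r normrN CC_normE d'E toC_lt => /(_ wd wz0).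
    rewrite CC_normE toC_le [(w - z) *: 1]mulr1 subrK -cmodN opprB.
    move=> h; rewrite -ler_pdivrMr ?cmod_gt0 // -cmodV -cmodM.
    by rewrite mulrBl mulfK // [_ / _]mulrC.
  move=> H; apply/cvgrPdist_le => e /CC_gt0P[e' e'0 ->].
  have [d d0 dH] := H _ e'0.
  apply/nbhs_ballP; exists (toC d) => /=; first by rewrite toC_lt.
  move=> h /=; rewrite /ball /= sub0r normrN CC_normE toC_lt => hd h0.
  have := dH (h + z); rewrite addrK => /(_ hd).
  rewrite [_ *: 1]mulr1 CC_normE toC_le => {}dH.
  rewrite -(ler_pM2r (x := cmod h)) ?cmod_gt0 // -cmodM -cmodN.
  by rewrite -mulNr opprB mulrBl [_^-1 *: _]mulrC mulfVK.
rewrite -E; split => [H|[H1 H2]].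
  have H1 : derivable f z 1 by apply/cvg_ex; exists l.
  by apply: DeriveDef => //; rewrite /derive; apply: cvg_lim H.
by rewrite -H2; move: H1 => /cvg_ex[l' ll]; rewrite /derive; apply/cvg_ex; exists l'.
Qed.

End Modulus.

(** * Bisection and the mean value inequality *)

Section Bisection.
Variable R : realType.

Lemma nested_intervals (A B : nat -> R) :
  (forall n, A n <= A n.+1) -> (forall n, B n.+1 <= B n) ->
  (forall n, A n <= B n) -> exists x, forall n, A n <= x <= B n.
Proof.
move=> A_incr B_decr AB.
have Am n k : A n <= A (n + k)%N.
  by elim: k => [|k IH]; rewrite ?addn0 // addnS (le_trans IH).
have Bm n k : B (n + k)%N <= B n.
  by elim: k => [|k IH]; rewrite ?addn0 // addnS (le_trans _ IH).
have AmB n m : A n <= B m.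
  apply: le_trans (Am n m) _; apply: le_trans (AB _) _.
  by rewrite addnC.
have A_ub m : ubound (range A) (B m) by move=> _ [n _ <-].
exists (sup (range A)) => n; apply/andP; split.
  by apply: ub_le_sup; [exists (B 0%N); apply: A_ub | exists n].
by apply: ge_sup; [exists (A 0%N), 0%N | apply: A_ub].
Qed.

Lemma half_pow_small (w e : R) : 0 < e -> exists n, w / 2 ^+ n < e.
Proof.
move=> e0; exists (Num.trunc (`|w| / e)).+1.
have we : 0 <= `|w| / e by rewrite divr_ge0 // ltW.
rewrite ltr_pdivrMr ?exprn_gt0 // mulrC -ltr_pdivrMr //.
apply: (@le_lt_trans _ _ (`|w| / e)).
  by rewrite ler_pM2r ?invr_gt0 // ler_norm.
apply: (lt_le_trans (truncnS_gt _)).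
by rewrite -natrX ler_nat ltnW // ltn_expl.
Qed.

(** Both the mean value inequality and Goursat's theorem bisect: the first one only
uses the coordinate in [a, b], with c = d. *)
Lemma bisection (Q : R -> R -> R -> R -> Prop) a b c d : a <= b -> c <= d ->
  (forall a b c d, a <= b -> c <= d -> Q a b c d ->
    let m := (a + b) / 2 in let m' := (c + d) / 2 in
    [\/ Q a m c m', Q a m m' d, Q m b c m' | Q m b m' d]) ->
  Q a b c d ->
  exists x y, [/\ a <= x <= b, c <= y <= d & forall e : R, 0 < e ->
    exists a' b' c' d', [/\ [/\ a <= a', b' <= b, c <= c' & d' <= d],
      a' <= x <= b', c' <= y <= d', b' - a' < e /\ d' - c' < e & Q a' b' c' d']].
Proof.
move=> ab cd halve Q0.
pose la (t : (R * R) * (R * R)) := t.1.1; pose ra (t : (R * R) * (R * R)) := t.1.2.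
pose lc (t : (R * R) * (R * R)) := t.2.1; pose rd (t : (R * R) * (R * R)) := t.2.2.
pose good t := [/\ la t <= ra t, lc t <= rd t & Q (la t) (ra t) (lc t) (rd t)].
have /choice[step stepP] : forall t, exists t', good t ->
    [/\ good t', la t <= la t' /\ ra t' <= ra t, lc t <= lc t' /\ rd t' <= rd t,
        ra t' - la t' = (ra t - la t) / 2 & rd t' - lc t' = (rd t - lc t) / 2].
  move=> [[p q] [r s]]; case: (pselect (good ((p, q), (r, s)))) => [G|nG];
    last by exists ((p, q), (r, s)).
  have [pq rs /halve] := G; rewrite /la /ra /lc /rd /= in pq rs *.
  case=> // H.
  - exists ((p, (p + q) / 2), (r, (r + s) / 2)) => _.
    by split; rewrite /good /la /ra /lc /rd /=; [split => //; lra|lra..].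
  - exists ((p, (p + q) / 2), ((r + s) / 2, s)) => _.
    by split; rewrite /good /la /ra /lc /rd /=; [split => //; lra|lra..].
  - exists (((p + q) / 2, q), (r, (r + s) / 2)) => _.
    by split; rewrite /good /la /ra /lc /rd /=; [split => //; lra|lra..].
  - exists (((p + q) / 2, q), ((r + s) / 2, s)) => _.
    by split; rewrite /good /la /ra /lc /rd /=; [split => //; lra|lra..].
pose t k := iter k step ((a, b), (c, d)).
have tG k : good (t k) by elim: k => // k /stepP[].
have tS k : [/\ la (t k) <= la (t k.+1) /\ ra (t k.+1) <= ra (t k),
    lc (t k) <= lc (t k.+1) /\ rd (t k.+1) <= rd (t k),
    ra (t k.+1) - la (t k.+1) = (ra (t k) - la (t k)) / 2
    & rd (t k.+1) - lc (t k.+1) = (rd (t k) - lc (t k)) / 2].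
  by have [] := stepP _ (tG k).
have in0 k : [/\ a <= la (t k), ra (t k) <= b, c <= lc (t k) & rd (t k) <= d].
  by elim: k => [|k [? ? ? ?]] //; have [[? ?] [? ?] _ _] := tS k; split; lra.
have width k : ra (t k) - la (t k) = (b - a) / 2 ^+ k /\
               rd (t k) - lc (t k) = (d - c) / 2 ^+ k.
  elim: k => [|k [IH1 IH2]]; first by rewrite expr0 !divr1.
  have [_ _ -> ->] := tS k.
  by rewrite IH1 IH2 exprSr invfM !mulrA.
have [x xP] : exists x, forall n, la (t n) <= x <= ra (t n).
  by apply: nested_intervals => k; have [[? ?] _ _ _] := tS k; have [] := tG k.
have [y yP] : exists y, forall n, lc (t n) <= y <= rd (t n).
  by apply: nested_intervals => k; have [_ [? ?] _ _] := tS k; have [] := tG k.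
exists x, y; split; [exact: (xP 0%N)|exact: (yP 0%N)|move=> e e0].
have [k kP] := half_pow_small (Num.max (b - a) (d - c)) e0.
exists (la (t k)), (ra (t k)), (lc (t k)), (rd (t k)); split => //.
  have [-> ->] := width k.
  by split; apply: le_lt_trans kP; rewrite ler_pM2r ?invr_gt0 ?exprn_gt0 //
    le_max lexx ?orbT.
by have [] := tG k.
Qed.

End Bisection.

Section Paths.
Variable R : realType.
Implicit Types (P Q : R -> CC R) (f : CC R -> CC R).

(** The norm of CC R takes its values in CC R, so that the derivative along a real
variable is stated directly. *)
Definition path_deriv P t l := forall e : R, 0 < e ->
  exists2 d : R, 0 < d & forall s, `|s - t| < d ->
    cmod (P s - P t - l * toC (s - t)) <= e * `|s - t|.

Lemma path_derivB P Q t l m :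
  path_deriv P t l -> path_deriv Q t m ->
  path_deriv (fun s => P s - Q s) t (l - m).
Proof.
move=> HP HQ e e0; have e20 : 0 < e / 2 by lra.
have [d1 d10 H1] := HP _ e20; have [d2 d20 H2] := HQ _ e20.
exists (Num.min d1 d2); first by rewrite lt_min d10.
move=> s; rewrite lt_min => /andP[/H1 h1 /H2 h2].
have -> : P s - Q s - (P t - Q t) - (l - m) * toC (s - t) =
  (P s - P t - l * toC (s - t)) - (Q s - Q t - m * toC (s - t)) by ring.
by apply: le_trans (ler_cmodB _ _) _; lra.
Qed.

Lemma path_deriv_Lip P t l : path_deriv P t l ->
  exists2 d : R, 0 < d & forall s, `|s - t| < d ->
    cmod (P s - P t) <= (cmod l + 1) * `|s - t|.
Proof.
move=> H; have [d d0 dH] := H _ ltr01; exists d => // s /dH h.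
have -> : P s - P t = (P s - P t - l * toC (s - t)) + l * toC (s - t) by ring.
by apply: le_trans (cmodD _ _) _; rewrite cmodM cmod_toC; lra.
Qed.

Lemma path_deriv_comp f P t l m : diff_at f (P t) l -> path_deriv P t m ->
  path_deriv (fun s => f (P s)) t (l * m).
Proof.
move=> Hf HP e e0.
have Nl := cmod_ge0 l; have Nm := cmod_ge0 m.
have [d1 d10 H1] := path_deriv_Lip HP.
have e10 : 0 < e / 2 / (cmod m + 1) by rewrite !divr_gt0 //; lra.
have [d2 d20 H2] := Hf _ e10.
have e20 : 0 < e / 2 / (cmod l + 1) by rewrite !divr_gt0 //; lra.
have [d3 d30 H3] := HP _ e20.
have d40 : 0 < d2 / (cmod m + 1) by rewrite divr_gt0 //; lra.
exists (Num.min (Num.min d1 d3) (d2 / (cmod m + 1))).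
  by rewrite !lt_min d10 d30.
move=> s; rewrite !lt_min => /andP[/andP[/H1 h1 /H3 h3] h2].
have Ps : cmod (P s - P t) < d2.
  by apply: (le_lt_trans h1); rewrite mulrC -ltr_pdivlMr //; lra.
have {}H2 := H2 _ Ps.
have -> : f (P s) - f (P t) - l * m * toC (s - t) =
  (f (P s) - f (P t) - l * (P s - P t)) + l * (P s - P t - m * toC (s - t)) by ring.
apply: le_trans (cmodD _ _) _; rewrite cmodM [e in leRHS]splitr mulrDl lerD //.
  apply: (le_trans H2); rewrite -mulrA ler_wpM2l //; first by lra.
  by rewrite mulrC ler_pdivrMr 1?mulrC //; lra.
have : cmod l * cmod (P s - P t - m * toC (s - t)) <=
   (cmod l + 1) * (e / 2 / (cmod l + 1) * `|s - t|).
  by apply: ler_pM => //; [exact: cmod_ge0|lra].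
by rewrite mulrA mulrCA divff ?mulr1 // gt_eqF //; lra.
Qed.

Lemma path_deriv_affine (z h : CC R) t : path_deriv (fun s => z + toC s * h) t h.
Proof.
move=> e e0; exists 1 => // s _.
have -> : z + toC s * h - (z + toC t * h) - h * toC (s - t) = 0.
  by rewrite rmorphB /=; ring.
by rewrite cmod0 mulr_ge0 // ltW.
Qed.

(** If the increment over [a, b] were too large, it would remain so, with the same
excess of slope, on arbitrarily small intervals around some point x; this
contradicts the existence of a derivative of modulus at most K at x. *)
Lemma path_mean_value P (l : R -> CC R) (K a b : R) : a <= b ->
  (forall t, a <= t <= b -> path_deriv P t (l t) /\ cmod (l t) <= K) ->
  cmod (P b - P a) <= K * (b - a).
Proof.
move=> ab HP; rewrite leNgt; apply/negP => lt_K.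
have [eq_ab|ne_ab] := eqVneq a b.
  by move: lt_K; rewrite eq_ab !subrr cmod0 mulr0 ltxx.
have ba0 : 0 < b - a by rewrite subr_gt0 lt_def eq_sym ne_ab.
pose eta := (cmod (P b - P a) / (b - a) - K) / 2.
have eta0 : 0 < eta.
  by rewrite divr_gt0 // subr_gt0 ltr_pdivlMr.
pose Q (a b c d : R) := a < b /\ (K + eta * 2) * (b - a) <= cmod (P b - P a).
have Q0 : Q a b 0 0.
  split; first by rewrite -subr_gt0.
  by rewrite /eta mulfVK ?pnatr_eq0 // addrC subrK mulfVK // gt_eqF.
have [|x [y [/andP[ax xb] _ small]]] := bisection ab (lexx 0) _ Q0.
  move=> {Q0} p q r s pq rs [pq' HQ] m m'.
  have mE : m - p = (q - p) / 2 /\ q - m = (q - p) / 2 by rewrite /m; split; field.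
  case: (leP ((K + eta * 2) * (m - p)) (cmod (P m - P p))) => h1.
    by apply: Or41; split => //; rewrite -subr_gt0 mE.1; lra.
  case: (leP ((K + eta * 2) * (q - m)) (cmod (P q - P m))) => h2.
    by apply: Or43; split => //; rewrite -subr_gt0 mE.2; lra.
  have := cmodD (P q - P m) (P m - P p).
  rewrite addrA subrK => h3; exfalso.
  move: (le_trans HQ h3); apply/negP; rewrite -ltNge.
  have -> : q - p = (q - m) + (m - p) by lra.
  by rewrite mulrDr; lra.
have axb : a <= x <= b by rewrite ax xb.
have [Hx Kx] := HP x axb.
have [d d0 dH] := Hx _ eta0.
have [p [q [_ [_ [_ /andP[px xq] _ [pq _] [pq0 HQ]]]]]] := small _ d0.
have := dH p; have := dH q.
rewrite [`|q - x|]ger0_norm ?subr_ge0 // [`|p - x|]ler0_norm ?subr_le0 //.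
move=> /(_ ltac:(lra)) hq /(_ ltac:(lra)) hp.
have : cmod (P q - P p) <= (K + eta) * (q - p).
  have -> : P q - P p = (P q - P x - l x * toC (q - x)) -
     (P p - P x - l x * toC (p - x)) + l x * toC (q - p).
    by rewrite !rmorphB /=; ring.
  apply: le_trans (cmodD _ _) _; rewrite cmodM cmod_toC.
  have := ler_cmodB (P q - P x - l x * toC (q - x)) (P p - P x - l x * toC (p - x)).
  rewrite [`|q - p|]ger0_norm ?subr_ge0; last by lra.
  have : cmod (l x) * (q - p) <= K * (q - p) by rewrite ler_wpM2r //; lra.
  by nra.
by nra.
Qed.

Lemma mean_value2 P Q (l m : R -> CC R) (K a b : R) : a <= b ->
  (forall t, a <= t <= b -> [/\ path_deriv P t (l t), path_deriv Q t (m t) &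
     cmod (l t - m t) <= K]) ->
  cmod ((P b - P a) - (Q b - Q a)) <= K * (b - a).
Proof.
move=> ab H.
have -> : (P b - P a) - (Q b - Q a) = (P b - Q b) - (P a - Q a) by ring.
apply: (@path_mean_value (fun s => P s - Q s) (fun s => l s - m s)) => //.
by move=> t /H[H1 H2 H3]; split => //; apply: path_derivB.
Qed.

Lemma mean_value f (f' : CC R -> CC R) z h K :
  (forall t : R, 0 <= t <= 1 -> diff_at f (z + toC t * h) (f' (z + toC t * h)) /\
     cmod (f' (z + toC t * h)) <= K) -> cmod (f (z + h) - f z) <= K * cmod h.
Proof.
move=> H.
have := @path_mean_value (fun s => f (z + toC s * h)) (fun s => f' (z + toC s * h) * h)
  (K * cmod h) 0 1 ler01.
rewrite rmorph0 rmorph1 mul1r mul0r addr0 subr0 mulr1; apply => t /H[Hf K0].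
split; last by rewrite cmodM ler_wpM2r // cmod_ge0.
exact: path_deriv_comp Hf (path_deriv_affine _ _ _).
Qed.

End Paths.

(** * Goursat's theorem on coordinate rectangles *)

Section Goursat.
Variable R : realType.
Implicit Types (P Q : R -> CC R) (F : CC R -> CC R).

Lemma path_Lipschitz P (l : R -> CC R) (K a b s t : R) :
  (forall t, a <= t <= b -> path_deriv P t (l t) /\ cmod (l t) <= K) ->
  a <= s <= b -> a <= t <= b -> cmod (P s - P t) <= K * `|s - t|.
Proof.
move=> H /andP[as_ sb] /andP[at_ tb]; case: (leP s t) => st.
  rewrite cmodB distrC ger0_norm ?subr_ge0 //.
  apply: (path_mean_value (l := l) st) => u /andP[su ut].
  by apply: H; apply/andP; split; lra.
rewrite ger0_norm ?subr_ge0; last exact: ltW.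
apply: (path_mean_value (l := l) (ltW st)) => u /andP[su ut].
by apply: H; apply/andP; split; lra.
Qed.

Lemma sub_itv (a b p q u : R) : a <= p -> q <= b -> p <= u <= q -> a <= u <= b.
Proof. by move=> ap qb /andP[pu uq]; rewrite (le_trans ap) ?(le_trans uq). Qed.

(** The integral over the boundary of a rectangle, expressed by antiderivatives along
the sides: for W(x, y) an antiderivative in y, the contribution of the two
vertical sides. *)
Definition box_diff (W : R -> R -> CC R) (a b c d : R) : CC R :=
  (W b d - W b c) - (W a d - W a c).

(** [box_diff] is additive under subdivision, so a quarter of the rectangle carries at
least a quarter of it, and the square of the half perimeter scales likewise. *)
Lemma box_diff_quarter W (k a b c d : R) (m := (a + b) / 2) (m' := (c + d) / 2) :
  k * ((b - a) + (d - c)) ^+ 2 <= cmod (box_diff W a b c d) ->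
  [\/ k * ((m - a) + (m' - c)) ^+ 2 <= cmod (box_diff W a m c m'),
      k * ((m - a) + (d - m')) ^+ 2 <= cmod (box_diff W a m m' d),
      k * ((b - m) + (m' - c)) ^+ 2 <= cmod (box_diff W m b c m') |
      k * ((b - m) + (d - m')) ^+ 2 <= cmod (box_diff W m b m' d)].
Proof.
move=> H; set q := k * (((b - a) + (d - c)) / 2) ^+ 2.
have mE : m - a = (b - a) / 2 /\ b - m = (b - a) / 2 by rewrite /m; split; field.
have mE' : m' - c = (d - c) / 2 /\ d - m' = (d - c) / 2 by rewrite /m'; split; field.
rewrite mE.1 mE.2 mE'.1 mE'.2 -mulrDl -/q.
have {}H : 4 * q <= cmod (box_diff W a b c d).
  by apply: le_trans H; rewrite /q expr_div_n le_eqVlt; apply/orP; left; apply/eqP; field.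
have [|h1] := leP q (cmod (box_diff W a m c m')); first by move=> h; apply: Or41.
have [|h2] := leP q (cmod (box_diff W a m m' d)); first by move=> h; apply: Or42.
have [|h3] := leP q (cmod (box_diff W m b c m')); first by move=> h; apply: Or43.
have [|h4] := leP q (cmod (box_diff W m b m' d)); first by move=> h; apply: Or44.
exfalso; move: H; apply/negP; rewrite -ltNge.
have -> : box_diff W a b c d = (box_diff W a m c m' + box_diff W a m m' d) +
   (box_diff W m b c m' + box_diff W m b m' d) by rewrite /box_diff; ring.
apply: le_lt_trans (cmodD _ _) _.
have := cmodD (box_diff W a m c m') (box_diff W a m m' d).
have := cmodD (box_diff W m b c m') (box_diff W m b m' d).
by lra.
Qed.

(** The first order expansion c0 + l (w - z0) of a function at z0 has a primitive; its
boundary integrals vanish, which is why only the remainder counts in [goursat]. *)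
Lemma affine_primitive (c0 l z0 w : CC R) :
  diff_at (fun u => c0 * u + l * (u - z0) ^+ 2 / 2) w (c0 + l * (w - z0)).
Proof.
move=> e e0; exists (e / (cmod l + 1)).
  by rewrite divr_gt0 //; have := cmod_ge0 l; lra.
move=> u uw.
have -> : c0 * u + l * (u - z0) ^+ 2 / 2 - (c0 * w + l * (w - z0) ^+ 2 / 2) -
  (c0 + l * (w - z0)) * (u - w) = (l / 2) * ((u - w) * (u - w)) by field.
rewrite !cmodM mulrA ler_wpM2r ?cmod_ge0 // cmodV.
have -> : cmod (2 : CC R) = 2.
  by rewrite -[2 in LHS](rmorph_nat (@toC R)) cmod_toC ger0_norm.
have Nl := cmod_ge0 l; have Nuw := cmod_ge0 (u - w).
have : cmod (u - w) * (cmod l + 1) < e by rewrite -ltr_pdivlMr //; lra.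
by nra.
Qed.

(** Here z(x, y) is any differentiable parametrization, U(x, .) integrates F dz along
vertical lines and V(., y) along horizontal ones, so that the conclusion says that
the integral of F dz over the boundary of the rectangle vanishes.  Around the point
selected by bisection, F is affine up to an error proportional to the size of
the rectangle, and the integral of the error is of second order with an
arbitrarily small constant. *)
Lemma goursat F (z zx zy U V : R -> R -> CC R) (K a b c d : R) :
  a <= b -> c <= d ->
  (forall x y, a <= x <= b -> c <= y <= d ->
    [/\ exists l, diff_at F (z x y) l,
        path_deriv (z^~ y) x (zx x y) /\ cmod (zx x y) <= K,
        path_deriv (z x) y (zy x y) /\ cmod (zy x y) <= K,
        path_deriv (U x) y (F (z x y) * zy x y)
      & path_deriv (V^~ y) x (F (z x y) * zx x y)]) ->
  box_diff U a b c d = box_diff V a b c d.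
Proof.
move=> ab cd H.
pose W x y := U x y - V x y.
have boxW p q r s : box_diff W p q r s = box_diff U p q r s - box_diff V p q r s.
  by rewrite /box_diff /W; ring.
apply/eqP; rewrite -subr_eq0 -boxW; apply: contraT; rewrite -cmod_gt0 => W0.
set L0 := (b - a) + (d - c).
have L00 : 0 < L0.
  rewrite lt_def; apply/andP; split; last by rewrite /L0; lra.
  apply: contraTneq W0 => L00.
  have -> : b = a by move: L00; rewrite /L0; lra.
  by rewrite /box_diff subrr cmod0 ltxx.
pose k := cmod (box_diff W a b c d) / L0 ^+ 2.
have k0 : 0 < k by rewrite divr_gt0 // exprn_gt0.
have K0 : 0 <= K.
  have [|//|_ [_ h] _ _ _] := H a c; first by rewrite lexx.
    by rewrite lexx.
  exact: le_trans (cmod_ge0 _) h.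
pose Q p q r s := 0 < (q - p) + (s - r) /\
  k * ((q - p) + (s - r)) ^+ 2 <= cmod (box_diff W p q r s).
have Q0 : Q a b c d.
  by split => //; rewrite -/L0 /k mulfVK // gt_eqF // exprn_gt0.
have [|x [y [xab ycd small]]] := bisection ab cd _ Q0.
  move=> {Q0} p q r s _ _ [L1 /box_diff_quarter HQ] m m'; rewrite /Q.
  have mE : m - p = (q - p) / 2 /\ q - m = (q - p) / 2 by rewrite /m; split; field.
  have mE' : m' - r = (s - r) / 2 /\ s - m' = (s - r) / 2 by rewrite /m'; split; field.
  case: HQ => HQ; [apply: Or41|apply: Or42|apply: Or43|apply: Or44]; split => //;
    by rewrite ?mE.1 ?mE.2 ?mE'.1 ?mE'.2; lra.
have [[l Fl] _ _ _ _] := H x y xab ycd.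
set z0 := z x y in Fl.
have K2 : 0 < 2 * K ^+ 2 + 1 by have := sqr_ge0 K; lra.
(* The estimate below is eps * (2 * K ^+ 2) * L ^+ 2, to be less than k * L ^+ 2. *)
pose eps := k / (2 * K ^+ 2 + 1).
have eps0 : 0 < eps by rewrite divr_gt0.
have [dl dl0 Hl] := Fl _ eps0.
have dK0 : 0 < dl / 2 / (K + 1) by rewrite !divr_gt0 //; lra.
have [p [q [r [s [[ap qb cr sd] /andP[px xq] /andP[ry ys] [pq rs] [Lp HQ]]]]]] := small _ dK0.
set L := (q - p) + (s - r) in Lp HQ.
have LK : K * L < dl.
  have : L * (K + 1) < dl.
    by rewrite -ltr_pdivlMr /L; lra.
  by nra.
(* A primitive of the affine part of F at z0; its boundary integral is zero. *)
pose W1 u := F z0 * u + l * (u - z0) ^+ 2 / 2.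
have Fz u v : p <= u <= q -> r <= v <= s ->
    cmod (F (z u v) - (F z0 + l * (z u v - z0))) <= eps * (K * L).
  move=> upq vrs; have uab := sub_itv ap qb upq; have vcd := sub_itv cr sd vrs.
  have h1 : cmod (z u v - z x v) <= K * `|u - x|.
    apply: (path_Lipschitz (P := z^~ v) (l := fun t => zx t v) (a := a) (b := b)) => // t tab.
    by have [] := H t v tab vcd.
  have h2 : cmod (z x v - z x y) <= K * `|v - y|.
    apply: (path_Lipschitz (l := fun t => zy x t) (a := c) (b := d)) => // t tab.
    by have [] := H x t xab tab.
  have h3 : cmod (z u v - z0) <= K * L.
    have -> : z u v - z0 = (z u v - z x v) + (z x v - z x y) by rewrite /z0; ring.
    apply: le_trans (cmodD _ _) _; apply: le_trans (lerD h1 h2) _.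
    rewrite -mulrDr ler_wpM2l // /L lerD // ler_norml.
      by move: upq xq px; clear; lra.
    by move: vrs ry ys; clear; lra.
  rewrite opprD addrA; apply: le_trans (Hl _ (le_lt_trans h3 LK)) _.
  by rewrite ler_wpM2l // ltW.
have hU u : p <= u <= q ->
    cmod ((U u s - U u r) - (W1 (z u s) - W1 (z u r))) <= eps * (K * L) * K * (s - r).
  move=> upq.
  have uab := sub_itv ap qb upq.
  apply: (mean_value2 (P := U u) (Q := fun v => W1 (z u v))
    (l := fun v => F (z u v) * zy u v)
    (m := fun v => (F z0 + l * (z u v - z0)) * zy u v)); first by lra.
  move=> v vrs.
  have vcd := sub_itv cr sd vrs.
  have [_ _ [dz Kz] dU _] := H u v uab vcd; split => //.
    exact: path_deriv_comp (affine_primitive _ _ _ _) dz.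
  by rewrite -mulrBl cmodM; apply: ler_pM; rewrite ?cmod_ge0 //; apply: Fz.
have hV v : r <= v <= s ->
    cmod ((V q v - V p v) - (W1 (z q v) - W1 (z p v))) <= eps * (K * L) * K * (q - p).
  move=> vrs.
  have vcd := sub_itv cr sd vrs.
  apply: (mean_value2 (P := V^~ v) (Q := fun u => W1 (z u v))
    (l := fun u => F (z u v) * zx u v)
    (m := fun u => (F z0 + l * (z u v - z0)) * zx u v)); first by lra.
  move=> u upq.
  have uab := sub_itv ap qb upq.
  have [_ [dz Kz] _ _ dV] := H u v uab vcd; split => //.
    exact: (path_deriv_comp (P := z^~ v) (affine_primitive _ _ _ _) dz).
  by rewrite -mulrBl cmodM; apply: ler_pM; rewrite ?cmod_ge0 //; apply: Fz.
have pq' : p <= q by lra.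
have rs' : r <= s by lra.
have hUq := hU q; have hUp := hU p; have hVs := hV s; have hVr := hV r.
rewrite !lexx pq' rs' /= in hUq hUp hVs hVr.
have {hUq hUp hVs hVr} : cmod (box_diff W p q r s) <=
    2 * (eps * (K * L) * K * (s - r)) + 2 * (eps * (K * L) * K * (q - p)).
  have -> : box_diff W p q r s =
    (((U q s - U q r) - (W1 (z q s) - W1 (z q r))) -
     ((U p s - U p r) - (W1 (z p s) - W1 (z p r)))) -
    (((V q s - V p s) - (W1 (z q s) - W1 (z p s))) -
     ((V q r - V p r) - (W1 (z q r) - W1 (z p r)))).
    by rewrite /box_diff /W; ring.
  apply: le_trans (ler_cmodB _ _) _; apply: lerD; apply: le_trans (ler_cmodB _ _) _.
    by rewrite mulr_natl mulr2n; apply: lerD; [apply: hUq|apply: hUp].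
  by rewrite mulr_natl mulr2n; apply: lerD; [apply: hVs|apply: hVr].
have -> : 2 * (eps * (K * L) * K * (s - r)) + 2 * (eps * (K * L) * K * (q - p)) =
   eps * (2 * K ^+ 2) * L ^+ 2 by rewrite /L; ring.
move=> /(le_trans HQ); rewrite ler_pM2r ?exprn_gt0 //.
suff : eps * (2 * K ^+ 2) < k by lra.
have -> : k = eps * (2 * K ^+ 2 + 1) by rewrite /eps mulfVK // gt_eqF.
by rewrite ltr_pM2l //; lra.
Qed.

End Goursat.

(** * Antiderivatives of continuous paths *)

Section Antiderivative.
Variable R : realType.
Implicit Types (P u : R -> CC R) (t : R).

Lemma real_deriv_path (p q : R -> R) t m n :
  is_derive t 1 p m -> is_derive t 1 q n ->
  path_deriv (fun s => toC (p s) + imagC R * toC (q s)) t (toC m + imagC R * toC n).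
Proof.
have small (g : R -> R) l : is_derive t 1 g l -> forall e, 0 < e ->
    exists2 d : R, 0 < d & forall s, `|s - t| < d ->
      `|g s - g t - l * (s - t)| <= e * `|s - t|.
  move=> [dg <-] e e0.
  have /cvgrPdist_le /(_ e e0) : ((fun h => h^-1 *: ((g \o shift t) (h *: 1) - g t))
      @ (0 : R)^') --> 'D_1 g t by exact: dg.
  rewrite /dnbhs /= => /nbhs_ballP [d /= d0 dH].
  exists d => // s sd.
  have [->|st] := eqVneq s t; first by rewrite !subrr mulr0 subr0 normr0 mulr0.
  have st0 : s - t != 0 by rewrite subr_eq0.
  have := dH (s - t); rewrite /ball /= sub0r normrN => /(_ sd st0).
  rewrite [(s - t) *: 1]mulr1 subrK distrC.
  move=> h; rewrite -ler_pdivrMr ?normr_gt0 // -normfV -normrM.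
  by rewrite mulrBl mulfK // [_ / _]mulrC.
move=> Hp Hq e e0; have e20 : 0 < e / 2 by lra.
have [d1 d10 H1] := small _ _ Hp _ e20; have [d2 d20 H2] := small _ _ Hq _ e20.
exists (Num.min d1 d2); first by rewrite lt_min d10.
move=> s; rewrite lt_min => /andP[/H1 h1 /H2 h2].
have -> : toC (p s) + imagC R * toC (q s) - (toC (p t) + imagC R * toC (q t)) -
    (toC m + imagC R * toC n) * toC (s - t) =
  toC (p s - p t - m * (s - t)) + imagC R * toC (q s - q t - n * (s - t)).
  by rewrite !(rmorphB, rmorphM) /=; ring.
by apply: le_trans (cmodD _ _) _; rewrite cmodM cmod_imagC mul1r !cmod_toC; lra.
Qed.

Lemma real_antiderivative (g : R -> R) (a b : R) : continuous g ->
  exists G : R -> R, forall t, a <= t <= b -> is_derive t 1 G (g t).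
Proof.
move=> cg.
have ig : (@lebesgue_measure R).-integrable `[a - 1, b + 1] (EFin \o g).
  apply: continuous_compact_integrable; first exact: segment_compact.
  exact: continuous_subspaceT.
exists (fun x => \int[@lebesgue_measure R]_(s in `[a - 1, x]) g s)%R.
move=> t /andP[at_ tb].
have [||dG GE] := @continuous_FTC1_closed _ g (a - 1) t (b + 1) _ ig _ (cg t).
- by lra.
- by lra.
by rewrite derive1E in GE; exact: (DeriveDef dG GE).
Qed.

Definition path_cont u t := forall e : R, 0 < e ->
  exists2 d : R, 0 < d & forall s, `|s - t| < d -> cmod (u s - u t) < e.

Lemma path_deriv_cont P t l : path_deriv P t l -> path_cont P t.
Proof.
move=> /path_deriv_Lip[d d0 H] e e0.
have Nl : 0 < cmod l + 1 by have := cmod_ge0 l; lra.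
exists (Num.min d (e / (cmod l + 1))); first by rewrite lt_min d0 divr_gt0.
move=> s; rewrite lt_min ltr_pdivlMr // mulrC => /andP[/H h].
exact: le_lt_trans.
Qed.

(** The fundamental theorem of calculus for the real and the imaginary parts, used on a
larger interval so that the derivatives at a and b are two-sided. *)
Lemma antiderivative u (a b : R) : a <= b ->
  (forall t, a <= t <= b -> path_cont u t) ->
  exists P, forall t, a <= t <= b -> path_deriv P t (u t).
Proof.
move=> ab cu.
(* Clamping to [a, b] makes the integrand continuous on the whole line. *)
pose k t := Num.max a (Num.min t b).
have kE t : a <= t <= b -> k t = t.
  by move=> /andP[? ?]; rewrite /k min_l // max_r.
have kab t : a <= k t <= b.
  by rewrite /k le_max lexx ge_max ab ge_min lexx orbT.
have kLip s t : `|k s - k t| <= `|s - t|.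
  clear cu; rewrite /k; case: (leP s b) => sb; case: (leP t b) => tb;
    rewrite ?(max_r ab); case: (leP a s) => h1; case: (leP a t) => h2;
    rewrite ler_norml; case: (ger0P (s - t)) => h3; apply/andP; split; lra.
have cont (g : CC R -> R) : (forall z w, g (z - w) = g z - g w) ->
    (forall z, `|g z| <= cmod z) -> continuous (fun t => g (u (k t))).
  move=> gB gN t; apply/cvgrPdist_lt => e e0.
  have [d d0 dH] := cu _ (kab t) _ e0.
  apply/nbhs_ballP; exists d => //= s; rewrite /ball /= => st.
  rewrite -gB; apply: le_lt_trans (gN _) _; rewrite cmodB; apply: dH.
  by apply: le_lt_trans (kLip _ _) _; rewrite distrC.
have [P1 H1] := real_antiderivative a b (cont _ (@ReB R) (@cmod_geRe R)).
have [P2 H2] := real_antiderivative a b (cont _ (@ImB R) (@cmod_geIm R)).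
exists (fun s => toC (P1 s) + imagC R * toC (P2 s)) => t tab.
by have := real_deriv_path (H1 t tab) (H2 t tab); rewrite kE // -CC_ReIm.
Qed.

End Antiderivative.

(** * The unit circle *)

Section Circle.
Variable R : realType.

Definition cis (t : R) : CC R := toC (cos t) + imagC R * toC (sin t).

Lemma imagC2 : imagC R * imagC R = -1.
Proof. by rewrite -expr2; exact: sqr_i. Qed.

Lemma cis_deriv t : path_deriv cis t (imagC R * cis t).
Proof.
have -> : imagC R * cis t = toC (- sin t) + imagC R * toC (cos t).
  by rewrite /cis mulrDr mulrA imagC2 rmorphN /=; ring.
exact: real_deriv_path.
Qed.

Lemma cmod_cis t : cmod (cis t) = 1.
Proof.
have -> : cis t = (cos t +i* sin t)%C.
  rewrite /cis /toC /imagC; apply/eqP.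
  by rewrite eq_complex /= !(mulr0, mul0r, mul1r, subr0, addr0, add0r) !eqxx.
by rewrite /cmod /= cos2Dsin2 sqrtr1.
Qed.

Lemma cis2pi : cis (pi *+ 2) = cis 0.
Proof. by rewrite /cis cos2pi sin2pi cos0 sin0. Qed.

End Circle.

(** * Cauchy estimate *)

Section CauchyEstimate.
Variable R : realType.
Variables (f f' : CC R -> CC R) (z0 : CC R) (rho : R).
Hypothesis rho0 : 0 < rho.
Hypothesis fD : forall z, cmod (z - z0) < rho -> diff_at f z (f' z).

Let phi z := (f z - f z0) / (z - z0).
Let circ (r t : R) : CC R := z0 + toC r * cis t.

Lemma diff_at_derivable (g : CC R -> CC R) z :
  (exists l, diff_at g z l) <-> derivable g z 1.
Proof.
split => [[l /diff_atP[]]//|dg].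
by exists ('D_1 g z); apply/diff_atP; apply: derivableP.
Qed.

Let phi_derivable z : cmod (z - z0) < rho -> z != z0 -> derivable phi z 1.
Proof.
move=> zrho zz0.
have df : derivable f z 1 by apply/diff_at_derivable; exists (f' z); apply: fD.
have dc : derivable (fun=> f z0) z 1 by exact: derivable_const.
have dz : derivable (fun w => w - z0) z 1.
  by apply: derivable_sub; [apply: derivable_var|apply: derivable_const].
apply: (derivable_mul (derivable_sub df dc)).
by apply: (derivable_inv _ dz); rewrite subr_eq0.
Qed.

Let cmod_circ r t : 0 < r -> cmod (circ r t - z0) = r.
Proof. by move=> r0; rewrite addrC addKr cmodM cmod_toC cmod_cis mulr1 gtr0_norm. Qed.

Let circ_neq r t : 0 < r -> circ r t != z0.
Proof. by move=> r0; rewrite -subr_eq0 -cmod_gt0 cmod_circ. Qed.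

Let circ_t r t : path_deriv (circ r) t (toC r * (imagC R * cis t)).
Proof.
have aff : diff_at (fun w => z0 + toC r * w) (cis t) (toC r).
  move=> e e0; exists 1 => // w _.
  have -> : z0 + toC r * w - (z0 + toC r * cis t) - toC r * (w - cis t) = 0 by ring.
  by rewrite cmod0 mulr_ge0 ?cmod_ge0 // ltW.
exact: path_deriv_comp aff (cis_deriv t).
Qed.

Let circ_r t r : path_deriv (circ^~ t) r (cis t).
Proof. exact: path_deriv_affine. Qed.

(** A(r) is i times the integral of phi over the circle of radius r with respect to
the angle t, that is, the integral of phi(z) dz / (z - z0), as dz = i (z - z0) dt.
It is independent of r by Goursat's theorem in polar coordinates: the radial sides
at the angles 0 and 2 pi cancel. *)
Lemma circle_mean : exists A : R -> CC R,
  (forall r0 r1, 0 < r0 -> r0 <= r1 -> r1 < rho -> A r0 = A r1) /\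
  forall r c e, 0 < r < rho ->
    (forall t, cmod (phi (circ r t) - c) <= e) ->
    cmod (A r - imagC R * c * toC (pi *+ 2)) <= e * (pi *+ 2).
Proof.
have pi2 : 0 <= (pi *+ 2 : R) by rewrite mulrn_wge0 // pi_ge0.
have /choice[U UP] : forall r, exists U : R -> CC R, 0 < r < rho ->
    forall t, 0 <= t <= pi *+ 2 -> path_deriv U t (imagC R * phi (circ r t)).
  move=> r; case: (boolP (0 < r < rho)) => [/andP[r0 rr]|_]; last by exists (fun=> 0).
  have [//|t _|U HU] := @antiderivative R (fun t => imagC R * phi (circ r t)) 0 (pi *+ 2).
    have [|l phil] := (diff_at_derivable (fun z => imagC R * phi z) (circ r t)).2.
      apply: derivable_mul; first exact: derivable_const.
      by apply: phi_derivable; rewrite ?cmod_circ ?circ_neq.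
    exact: path_deriv_cont (path_deriv_comp phil (circ_t r t)).
  by exists U.
exists (fun r => U r (pi *+ 2) - U r 0); split.
  move=> r0 r1 r00 r01 r1r.
  (* The form F dz is i * phi dt on circles and phi dr / r on rays. *)
  pose F z := phi z / (z - z0).
  have FD r t : r0 <= r <= r1 -> exists l, diff_at F (circ r t) l.
    move=> /andP[rr0 rr1]; have r_gt0 : 0 < r by lra.
    have dz : derivable (fun w => w - z0) (circ r t) 1.
      by apply: derivable_sub; [apply: derivable_var|apply: derivable_const].
    apply/diff_at_derivable; apply: derivable_mul.
      by apply: phi_derivable; rewrite ?cmod_circ ?circ_neq //; lra.
    by apply: (derivable_inv _ dz); rewrite subr_eq0 circ_neq.
  have /choice[V VP] : forall t, exists V : R -> CC R,
      forall r, r0 <= r <= r1 -> path_deriv V r (F (circ r t) * cis t).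
    move=> t; apply: (antiderivative (u := fun r => F (circ r t) * cis t)) => // r rr.
    have [l Fl] := FD r t rr.
    have [|m Gm] := (diff_at_derivable (fun z => F z * cis t) (circ r t)).2.
      apply: derivable_mul; last exact: derivable_const.
      by apply/diff_at_derivable; exists l.
    exact: path_deriv_cont (path_deriv_comp (P := circ^~ t) Gm (circ_r t r)).
  have := @goursat R F circ (fun r t => cis t) (fun r t => toC r * (imagC R * cis t)) U
    (fun r t => V t r) (1 + rho) r0 r1 0 (pi *+ 2) r01 pi2.
  have V0 : (V (pi *+ 2) r1 - V (pi *+ 2) r0) - (V 0 r1 - V 0 r0) = 0.
    apply/eqP; rewrite -cmod_eq0 eq_le cmod_ge0 andbT -[leRHS](mul0r (r1 - r0)).
    apply: (mean_value2 (l := fun r => F (circ r (pi *+ 2)) * cis (pi *+ 2))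
      (m := fun r => F (circ r 0) * cis 0)) => // r rr.
    split; [exact: VP|exact: VP|].
    by rewrite /circ cis2pi subrr cmod0.
  have -> : box_diff (fun r t => V t r) r0 r1 0 (pi *+ 2) = 0.
    by rewrite -V0 /box_diff; ring.
  move=> H; apply/esym/eqP; rewrite -subr_eq0; apply/eqP; rewrite -{}H //.
  move=> r t rr tt; have /andP[rr0 rr1] := rr; have r_gt0 : 0 < r by lra.
  split; first exact: FD.
  - by split; [exact: circ_r | rewrite cmod_cis; lra].
  - by split; [exact: circ_t | rewrite !cmodM cmod_imagC cmod_cis cmod_toC gtr0_norm //; lra].
  - have -> : F (circ r t) * (toC r * (imagC R * cis t)) = imagC R * phi (circ r t).
      have -> : toC r * (imagC R * cis t) = imagC R * (circ r t - z0) by rewrite /circ; ring.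
      by rewrite /F mulrCA mulfVK // subr_eq0 circ_neq.
    by apply: UP => //; apply/andP; split; lra.
  - exact: VP.
move=> r c e rr phic.
have /andP[r_gt0 _] := rr.
have := @mean_value2 R (U r) (fun t => toC t * (imagC R * c)) (fun t => imagC R * phi (circ r t))
  (fun _ => imagC R * c) e 0 (pi *+ 2) pi2.
rewrite rmorph0 mul0r !subr0 [_ * toC _]mulrC; apply => t tt.
split; first exact: UP.
  have := path_deriv_affine 0 (imagC R * c) t.
  by congr path_deriv; apply/funext => s; rewrite add0r.
by rewrite -mulrBr cmodM cmod_imagC mul1r.
Qed.

(** The mean of phi(z) = (f(z) - f(z0)) / (z - z0) over a circle tends to f'(z0) as the
radius tends to 0, and it does not depend on the radius; over the circle of
radius rho / 2 it is bounded by 2 M / (rho / 2). *)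
Lemma cauchy_estimate (M : R) : (forall z, cmod (z - z0) < rho -> cmod (f z) <= M) ->
  cmod (f' z0) <= 4 * M / rho.
Proof.
move=> fM; have [A [A_const A_mean]] := circle_mean.
have pi2 : 0 < (pi *+ 2 : R) by rewrite mulrn_wgt0 // pi_gt0.
have z0rho : cmod (z0 - z0) < rho by rewrite subrr cmod0.
rewrite -(ler_pM2r pi2); apply/ler_addgt0Pr => e e0.
have e20 : 0 < e / (pi *+ 2) by rewrite divr_gt0.
have [d d0 dH] := fD z0rho e20.
pose r0 := Num.min (d / 2) (rho / 2).
have r00 : 0 < r0 by rewrite lt_min !divr_gt0.
have r0d : r0 < d by rewrite gt_min; apply/orP; left; lra.
have r0rho : r0 <= rho / 2 by rewrite ge_min lexx orbT.
have h1 : cmod (A (rho / 2)) <= 4 * M / rho * (pi *+ 2).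
  have := A_mean (rho / 2) 0 (4 * M / rho); rewrite mulr0 mul0r subr0; apply.
    by apply/andP; split; lra.
  move=> t; rewrite subr0 /phi cmodM cmodV cmod_circ; last by lra.
  have -> : 4 * M / rho = (M + M) / (rho / 2) by field; lra.
  rewrite ler_wpM2r ?invr_ge0 //; first by lra.
  apply: le_trans (ler_cmodB _ _) _; apply: lerD; apply: fM => //.
  by rewrite cmod_circ; lra.
have h2 : cmod (A r0 - imagC R * f' z0 * toC (pi *+ 2)) <= e.
  rewrite -[e in leRHS](@divfK _ (pi *+ 2)) ?gt_eqF //; apply: A_mean.
    by apply/andP; split; lra.
  move=> t; have h := dH (circ r0 t); rewrite !cmod_circ // in h; have {}h := h r0d.
  have E : f (circ r0 t) - f z0 - f' z0 * (circ r0 t - z0) =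
      (phi (circ r0 t) - f' z0) * (circ r0 t - z0).
    by rewrite mulrBl /phi divfK // subr_eq0 circ_neq.
  by move: h; rewrite E cmodM cmod_circ // ler_pM2r.
have {h2} : cmod (imagC R * f' z0 * toC (pi *+ 2)) <= cmod (A r0) + e.
  have -> : imagC R * f' z0 * toC (pi *+ 2) =
    A r0 - (A r0 - imagC R * f' z0 * toC (pi *+ 2)) by ring.
  by apply: le_trans (ler_cmodB _ _) _; rewrite lerD2l.
rewrite !cmodM cmod_imagC mul1r cmod_toC (gtr0_norm pi2) (A_const _ (rho / 2)) //; last by lra.
by move=> h2; apply: (le_trans h2); rewrite lerD2r.
Qed.

End CauchyEstimate.

(** * Removable singularities *)

Section Regularity.
Variable R : realType.
Implicit Types (f g : CC R -> CC R) (z w h : CC R).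

Definition holo_ball f (f' : CC R -> CC R) z0 (rho : R) :=
  forall z, cmod (z - z0) < rho -> diff_at f z (f' z).

Lemma cmod_triangle z0 z w (a b : R) : cmod (z - z0) < a -> cmod (w - z) < b -> cmod (w - z0) < a + b.
Proof.
have -> : w - z0 = (z - z0) + (w - z) by ring.
by move=> h1 h2; apply: le_lt_trans (cmodD _ _) _; apply: ltrD.
Qed.

Lemma cmod_segment (t : R) h : 0 <= t <= 1 -> cmod (toC t * h) <= cmod h.
Proof.
by move=> /andP[t0 t1]; rewrite cmodM cmod_toC ger0_norm // ler_piMl ?cmod_ge0.
Qed.

Lemma diff_at_sub f g z l m : diff_at f z l -> diff_at g z m ->
  diff_at (fun w => f w - g w) z (l - m).
Proof. by move=> /diff_atP h1 /diff_atP h2; apply/diff_atP; apply: is_derive_sub. Qed.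

Lemma diff_at_translate f h z l : diff_at f (z + h) l -> diff_at (fun w => f (w + h)) z l.
Proof.
move=> H e /H[d d0 dH]; exists d => // w wz.
have E : w + h - (z + h) = w - z by ring.
by have := dH (w + h); rewrite E; apply.
Qed.

(** On the ball of radius 3 rho / 4, the Cauchy estimate on balls of radius rho / 4
bounds f' by 16 M / rho. *)
Lemma increment_bound f f' z0 rho (M : R) h : 0 < rho -> holo_ball f f' z0 rho ->
  (forall z, cmod (z - z0) < rho -> cmod (f z) <= M) -> cmod h < rho / 4 ->
  let g w := f (w + h) - f w in
  holo_ball g (fun w => f' (w + h) - f' w) z0 (rho / 2) /\
  forall z, cmod (z - z0) < rho / 2 -> cmod (g z) <= 16 * M / rho * cmod h.
Proof.
move=> rho0 Hf fM hh g.
have shift z k : cmod (z - z0) < rho / 2 -> cmod k < rho / 4 -> cmod (z + k - z0) < 3 * rho / 4.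
  move=> h1 h2; have -> : 3 * rho / 4 = rho / 2 + rho / 4 by field.
  by apply: (cmod_triangle h1); rewrite addrC addKr.
split=> z hz; first last.
  apply: (mean_value (f' := f')) => t t01.
  have hth := shift z (toC t * h) hz (le_lt_trans (cmod_segment h t01) hh).
  split; first by apply: Hf; clear -hth rho0; lra.
  have -> : 16 * M / rho = 4 * M / (rho / 4) by field; rewrite gt_eqF.
  apply: (@cauchy_estimate R f f' (z + toC t * h) (rho / 4)).
  - by rewrite divr_gt0.
  - move=> w hw; apply: Hf; apply: lt_le_trans (cmod_triangle hth hw) _.
    by clear -rho0; lra.
  - move=> w hw; apply: fM; apply: lt_le_trans (cmod_triangle hth hw) _.
    by clear -rho0; lra.
apply: diff_at_sub; first apply: diff_at_translate; apply: Hf.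
  by have := shift z h hz hh; clear -rho0; lra.
by clear -rho0 hz; lra.
Qed.

(** The Cauchy estimate for the increment w |-> f(w + h) - f(w), whose bound contains the
factor cmod h. *)
Lemma derivative_Lipschitz f f' z0 rho (M : R) h z : 0 < rho -> holo_ball f f' z0 rho ->
  (forall z, cmod (z - z0) < rho -> cmod (f z) <= M) -> cmod h < rho / 4 ->
  cmod (z - z0) < rho / 4 ->
  cmod (f' (z + h) - f' z) <= 256 * M / rho ^+ 2 * cmod h.
Proof.
move=> rho0 Hf fM hh hz; have [Hg gM] := increment_bound rho0 Hf fM hh.
have -> : 256 * M / rho ^+ 2 * cmod h = 4 * (16 * M / rho * cmod h) / (rho / 4).
  by field; rewrite gt_eqF.
have sub w : cmod (w - z) < rho / 4 -> cmod (w - z0) < rho / 2.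
  by move=> hw; have := cmod_triangle hz hw; clear -rho0; lra.
apply: (cauchy_estimate (f := fun w => f (w + h) - f w)
  (f' := fun w => f' (w + h) - f' w)); first by rewrite divr_gt0.
  by move=> w /sub; apply: Hg.
by move=> w /sub; apply: gM.
Qed.

(** [derivative_Lipschitz] for the increment w |-> f(w + l) - f(w), integrated along the
segment from z0 to z0 + h. *)
Lemma second_difference f f' z0 rho (M : R) h l : 0 < rho -> holo_ball f f' z0 rho ->
  (forall z, cmod (z - z0) < rho -> cmod (f z) <= M) -> cmod h < rho / 8 -> cmod l < rho / 8 ->
  cmod (f (z0 + h + l) - f (z0 + h) - f (z0 + l) + f z0 - (f' (z0 + l) - f' z0) * h) <=
    4 ^+ 7 * M / rho ^+ 3 * cmod l * cmod h ^+ 2.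
Proof.
move=> rho0 Hf fM hh hl.
have hl' : cmod l < rho / 4 by clear -hl rho0; lra.
have rho20 : 0 < rho / 2 by rewrite divr_gt0.
have [Hg gM] := increment_bound rho0 Hf fM hl'.
set c := f' (z0 + l) - f' z0.
have -> : 4 ^+ 7 * M / rho ^+ 3 * cmod l * cmod h ^+ 2 =
   (256 * (16 * M / rho * cmod l) / (rho / 2) ^+ 2 * cmod h) * cmod h.
  by field; rewrite gt_eqF.
have -> : f (z0 + h + l) - f (z0 + h) - f (z0 + l) + f z0 - c * h =
  ((f (z0 + h + l) - f (z0 + h)) - c * (z0 + h)) - ((f (z0 + l) - f z0) - c * z0) by ring.
apply: (mean_value (f := fun w => (f (w + l) - f w) - c * w)
  (f' := fun w => (f' (w + l) - f' w) - c)) => t t01.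
have hth : cmod (toC t * h) < rho / 8 := le_lt_trans (cmod_segment h t01) hh.
split.
  apply: diff_at_sub.
    apply: Hg; rewrite addrC addKr; clear -hth rho0; lra.
  apply/diff_atP; have := is_derive_mul (is_derive_cst c (z0 + toC t * h) (1 : CC R))
    (is_derive_id (z0 + toC t * h) (1 : CC R)).
  by rewrite mulr1 mulr0 addr0.
apply: le_trans (_ : _ <= 256 * (16 * M / rho * cmod l) / (rho / 2) ^+ 2 * cmod (toC t * h)) _.
  apply: (derivative_Lipschitz rho20 Hg gM); last by rewrite subrr cmod0 divr_gt0.
  by clear -hth rho0; lra.
have M0 : 0 <= M by apply: le_trans (cmod_ge0 (f z0)) (fM _ _); rewrite subrr cmod0.
apply: ler_wpM2l; last exact: cmod_segment.
by rewrite !mulr_ge0 ?invr_ge0 ?exprn_ge0 ?cmod_ge0 // ltW.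
Qed.

(** The limit is the supremum of the lower bounds g(h) - K |h|: each of them is at most
each upper bound g(l) + K |l|. *)
Lemma real_limit_of_Cauchy (g : CC R -> R) (K d : R) : 0 < d ->
  (forall h l, h != 0 -> l != 0 -> cmod h < d -> cmod l < d -> `|g h - g l| <= K * (cmod h + cmod l)) ->
  exists c, forall h, h != 0 -> cmod h < d -> `|g h - c| <= K * cmod h.
Proof.
move=> d0 H; pose S := [set x | exists h, [/\ h != 0, cmod h < d & x = g h - K * cmod h]].
have ub l : l != 0 -> cmod l < d -> ubound S (g l + K * cmod l).
  move=> l0 ld _ [h [h0 hd ->]]; have := H h l h0 l0 hd ld.
  by rewrite ler_norml mulrDr => /andP[_]; clear; lra.
have Nd : cmod (toC (d / 2)) < d.
  by rewrite cmod_toC ger0_norm ?divr_ge0 //; [clear -d0; lra|exact: ltW].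
have d20 : toC (d / 2) != 0.
  by rewrite -cmod_gt0 cmod_toC normr_gt0 gt_eqF // divr_gt0.
exists (sup S) => h h0 hd; rewrite ler_norml; apply/andP; split.
  rewrite lerBrDr addrC lerBlDr; apply: ge_sup; last exact: ub.
  by exists (g (toC (d / 2)) - K * cmod (toC (d / 2))), (toC (d / 2)).
rewrite lerBlDr addrC -lerBlDr; apply: ub_le_sup; last by exists h.
by exists (g (toC (d / 2)) + K * cmod (toC (d / 2))); apply: ub.
Qed.

Lemma limit_of_Cauchy (k : CC R -> CC R) (K d : R) : 0 < d ->
  (forall h l, h != 0 -> l != 0 -> cmod h < d -> cmod l < d -> cmod (k h - k l) <= K * (cmod h + cmod l)) ->
  exists c, forall h, h != 0 -> cmod h < d -> cmod (k h - c) <= 2 * K * cmod h.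
Proof.
move=> d0 H.
have [h l h0 l0 hd ld|a aP] := @real_limit_of_Cauchy (fun h => ReC (k h)) K d d0.
  by rewrite -ReB; apply: le_trans (cmod_geRe _) (H _ _ _ _ _ _).
have [h l h0 l0 hd ld|b bP] := @real_limit_of_Cauchy (fun h => ImC (k h)) K d d0.
  by rewrite -ImB; apply: le_trans (cmod_geIm _) (H _ _ _ _ _ _).
exists (toC a + imagC R * toC b) => h h0 hd.
have -> : k h - (toC a + imagC R * toC b) = toC (ReC (k h) - a) + imagC R * toC (ImC (k h) - b).
  by rewrite {1}[k h]CC_ReIm !rmorphB /=; ring.
apply: le_trans (cmodD _ _) _; rewrite cmodM cmod_imagC mul1r !cmod_toC.
by have := lerD (aP h h0 hd) (bP h h0 hd); rewrite -mulrDl mulr_natl mulr2n.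
Qed.

(** Let D(h) = f'(z0 + h) - f'(z0).  The second difference of f with increments h and l
is symmetric in h and l, and by [second_difference] it is close to both D(l) h and
D(h) l.  Hence D(h) / h and D(l) / l differ by O(|h| + |l|): they have a limit, which
is the second derivative, and integrating D gives the expansion. *)
Lemma second_order_expansion f f' z0 rho0 : 0 < rho0 -> holo_ball f f' z0 rho0 ->
  exists c K d, 0 < d /\ forall h, cmod h < d ->
    cmod (f (z0 + h) - f z0 - f' z0 * h - c * h ^+ 2) <= K * cmod h ^+ 3.
Proof.
move=> rho00 Hf0.
have [rho [M [rho_gt0 Hf fM]]] : exists rho M, [/\ 0 < rho, holo_ball f f' z0 rho &
    forall z, cmod (z - z0) < rho -> cmod (f z) <= M].
  have z0rho : cmod (z0 - z0) < rho0 by rewrite subrr cmod0.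
  have [d d0 dH] := Hf0 _ z0rho _ (@ltr01 R).
  exists (Num.min d rho0), (cmod (f z0) + (1 + cmod (f' z0)) * d).
  split; [by rewrite lt_min d0| |] => z; rewrite lt_min => /andP[zd zr].
    exact: Hf0.
  have -> : f z = f z0 + ((f z - f z0 - f' z0 * (z - z0)) + f' z0 * (z - z0)) by ring.
  apply: le_trans (cmodD _ _) _; rewrite lerD2l; apply: le_trans (cmodD _ _) _.
  rewrite mulrDl cmodM; apply: lerD; last by rewrite ler_wpM2l ?cmod_ge0 // ltW.
  by apply: le_trans (dH _ zd) _; rewrite !mul1r ltW.
have M0 : 0 <= M by apply: le_trans (cmod_ge0 (f z0)) (fM _ _); rewrite subrr cmod0.
pose K := 4 ^+ 7 * M / rho ^+ 3.
have K0 : 0 <= K by rewrite !mulr_ge0 ?invr_ge0 ?exprn_ge0 // ltW.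
pose D h := f' (z0 + h) - f' z0.
have rho80 : 0 < rho / 8 by rewrite divr_gt0.
have [h l h0 l0 hd ld|c cP] := @limit_of_Cauchy (fun h => D h / h) K (rho / 8) rho80.
  have h1 := second_difference rho_gt0 Hf fM hd ld.
  have h2 := second_difference rho_gt0 Hf fM ld hd.
  rewrite -/K -/(D h) -/(D l) in h1 h2.
  have Nh : 0 < cmod h by rewrite cmod_gt0.
  have Nl : 0 < cmod l by rewrite cmod_gt0.
  rewrite -(ler_pM2r (mulr_gt0 Nh Nl)) -!cmodM.
  have -> : (D h / h - D l / l) * (h * l) = D h * l - D l * h by field; rewrite h0 l0.
  have -> : D h * l - D l * h =
    (f (z0 + h + l) - f (z0 + h) - f (z0 + l) + f z0 - D l * h) -
    (f (z0 + l + h) - f (z0 + l) - f (z0 + h) + f z0 - D h * l).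
    by rewrite (addrAC z0 l h); ring.
  apply: le_trans (ler_cmodB _ _) _; apply: le_trans (lerD h1 h2) _.
  by rewrite cmodM le_eqVlt; apply/orP; left; apply/eqP; ring.
exists (c / 2), (2 * K), (rho / 8); split => // h hd.
have -> : 2 * K * cmod h ^+ 3 = (2 * K * cmod h ^+ 2) * cmod h by ring.
have -> : f (z0 + h) - f z0 - f' z0 * h - c / 2 * h ^+ 2 =
  (f (z0 + h) - (f' z0 * (z0 + h) + c * ((z0 + h) - z0) ^+ 2 / 2)) -
  (f z0 - (f' z0 * z0 + c * (z0 - z0) ^+ 2 / 2)) by field.
apply: (mean_value (f := fun w => f w - (f' z0 * w + c * (w - z0) ^+ 2 / 2))
   (f' := fun w => f' w - (f' z0 + c * (w - z0)))) => t t01.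
have hth := cmod_segment h t01.
have htd := le_lt_trans hth hd.
split.
  apply: diff_at_sub; last exact: affine_primitive.
  by apply: Hf; rewrite addrC addKr; clear -htd rho_gt0; lra.
rewrite opprD addrA -/(D _) [z0 + _ - z0]addrC addKr.
have [th0|th0] := eqVneq (toC t * h) 0.
  rewrite th0 /D addr0 mulr0 !subrr cmod0.
  by apply: mulr_ge0; [exact: mulr_ge0 | exact: exprn_ge0 (cmod_ge0 h)].
have -> : D (toC t * h) - c * (toC t * h) = (D (toC t * h) / (toC t * h) - c) * (toC t * h).
  by rewrite mulrBl divfK.
rewrite cmodM expr2 mulrA; apply: ler_pM; rewrite ?cmod_ge0 //.
apply: le_trans (cP _ th0 htd) _.
by apply: ler_wpM2l => //; rewrite mulr_ge0.
Qed.

(** When a lies in D, the value of the quotient at a is f'(a), and its derivative there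
is read off [second_order_expansion]; elsewhere z - a does not vanish. *)
Lemma removable_singularity (D : set (CC R)) f a :
  (forall z, D z -> exists2 d : R, 0 < d & forall w, cmod (w - z) < d -> D w) ->
  (forall z, D z -> derivable f z 1) -> (D a -> f a = 0) ->
  exists2 g, forall z, D z -> derivable g z 1 &
    forall z, D z -> f z = (z - a) * g z.
Proof.
move=> Dopen df fa.
pose f' z := 'D_1 f z.
have Hf z : D z -> diff_at f z (f' z).
  by move=> Dz; apply/diff_atP; apply: derivableP; apply: df.
exists (fun z => if z == a then f' a else f z / (z - a)) => z Dz; last first.
  have [za|za] := eqVneq z a; last by rewrite mulrC divfK // subr_eq0.
  by rewrite za subrr mul0r fa // -za.
apply/diff_at_derivable; have [za|za] := eqVneq z a; last first.
  have [|l Hl] := (diff_at_derivable (fun w => f w / (w - a)) z).2.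
    apply: derivable_mul; first exact: df.
    apply: derivable_inv; first by rewrite subr_eq0.
    by apply: derivable_sub; [apply: derivable_var|apply: derivable_const].
  exists l => e /Hl[d d0 dH]; exists (Num.min d (cmod (z - a))).
    by rewrite lt_min d0 cmod_gt0 subr_eq0.
  move=> w; rewrite lt_min => /andP[wd wa].
  have /negPf-> : w != a by apply: contraTneq wa => ->; rewrite cmodB ltxx.
  by rewrite (negPf za); apply: dH.
subst z; have [d d0 dD] := Dopen a Dz.
have [|c [K [d1 [d10 H]]]] := @second_order_expansion f f' a d d0.
  by move=> w /dD /Hf.
exists c => e e0; have Ke0 : 0 < e / (`|K| + 1).
  by rewrite divr_gt0 // ltr_wpDl.
exists (Num.min d1 (e / (`|K| + 1))); first by rewrite lt_min d10.
move=> w; rewrite lt_min => /andP[wd we].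
rewrite eqxx; have [->|wa] := eqVneq w a; first by rewrite !subrr mulr0 subr0 cmod0 mulr0.
have wa0 : 0 < cmod (w - a) by rewrite cmod_gt0 subr_eq0.
have := H _ wd; rewrite (addrC a) subrK fa // subr0 => {}H.
have : cmod ((f w / (w - a) - f' a - c * (w - a)) * (w - a)) <= K * cmod (w - a) ^+ 3.
  by apply: le_trans H; rewrite le_eqVlt; apply/orP; left; apply/eqP; congr cmod;
    field; rewrite subr_eq0.
rewrite cmodM exprSr mulrA ler_pM2r // => /le_trans; apply.
rewrite expr2 mulrA ler_pM2r //; apply: le_trans (ler_wpM2r (cmod_ge0 _) (ler_norm K)) _.
move: we; rewrite ltr_pdivlMr ?ltr_wpDl // mulrDr mulr1 mulrC => we.
by apply/ltW; apply: le_lt_trans we; rewrite lerDl cmod_ge0.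
Qed.

End Regularity.

(** * Values of rational functions *)

Local Notation "p %:F" := (FracField.tofrac p).

Section RationalValues.
Local Open Scope quotient_scope.
Variable C : numClosedFieldType.
Implicit Types (x y : ratfun C) (p q : {poly C}) (s : sphere C) (c : C).

Lemma fraction_quotient x : exists p q, q != 0 /\ x = p%:F / q%:F.
Proof.
elim/quotW: x => r; exists (frac r).1, (frac r).2; split; first exact: denom_ratioP.
unlock FracField.tofrac.
rewrite -[X in _ * X]FracField.pi_inv -[RHS]FracField.pi_mul.
rewrite /FracField.mulf /FracField.invf !numden_Ratio ?oner_eq0 ?denom_ratioP //.
by rewrite mulr1 mul1r Ratio_numden.
Qed.

Lemma coprime_quotient x : exists pq : {poly C} * {poly C},
  [&& pq.2 != 0, coprimep pq.1 pq.2 & x == pq.1%:F / pq.2%:F].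
Proof.
have [p [q [q0 ->]]] := fraction_quotient x.
pose d := gcdp p q; have d0 : d != 0 by rewrite gcdp_eq0 negb_and q0 orbT.
have pE : p = p %/ d * d by rewrite divpK // dvdp_gcdl.
have qE : q = q %/ d * d by rewrite divpK // dvdp_gcdr.
have q0' : q %/ d != 0 by apply: contraNneq q0 => h; rewrite qE h mul0r.
exists (p %/ d, q %/ d); apply/and3P; split => //=.
  by rewrite coprimep_div_gcd // q0 orbT.
apply/eqP; rewrite {1}pE {1}qE !tofracM invfM mulrACA divff ?mulr1 //.
by rewrite tofrac_eq0.
Qed.

(** A coprime representation: its denominator vanishes exactly where the function has no
finite value ([ratvalP]). *)
Definition ratnum_den x := xchoose (coprime_quotient x).
Definition ratnum x : {poly C} := (ratnum_den x).1.
Definition ratden x : {poly C} := (ratnum_den x).2.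

Lemma ratden_neq0 x : ratden x != 0.
Proof. by have /and3P[] := xchooseP (coprime_quotient x). Qed.
Lemma coprime_ratnum_den x : coprimep (ratnum x) (ratden x).
Proof. by have /and3P[] := xchooseP (coprime_quotient x). Qed.
Lemma ratnum_denE x : x = (ratnum x)%:F / (ratden x)%:F.
Proof. by have /and3P[_ _ /eqP] := xchooseP (coprime_quotient x). Qed.

Lemma quotient_eq p q p' q' : q != 0 -> q' != 0 ->
  (p%:F / q%:F == p'%:F / q'%:F) = (p * q' == p' * q).
Proof. by move=> q0 q0'; rewrite eqr_div ?tofrac_eq0 // -!tofracM tofrac_eq. Qed.

Definition rateval x (z : C) : C := (ratnum x).[z] / (ratden x).[z].

Lemma ratvalP x z c : ratval x (Some z) c <-> (ratden x).[z] != 0 /\ c = rateval x z.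
Proof.
split=> [[p [q [xE [qz ->]]]]|[dz ->]]; last by exists (ratnum x), (ratden x); split; first exact: ratnum_denE.
have q0 : q != 0 by apply: contraNneq qz => ->; rewrite horner0.
have /eqP E : ratnum x * q == p * ratden x.
  by rewrite -quotient_eq ?ratden_neq0 // -ratnum_denE xE.
have /dvdpP[r qE] : ratden x %| q.
  have := coprime_ratnum_den x; rewrite coprimep_sym => /Gauss_dvdpr <-.
  by rewrite E dvdp_mull.
have dz : (ratden x).[z] != 0 by apply: contraNneq qz => h; rewrite qE hornerM h mulr0.
split => //; apply/eqP; rewrite /rateval eqr_div // -!hornerM E; exact: eqxx.
Qed.

Lemma coef_mul_top p q (a b : nat) : (size p <= a.+1)%N -> (size q <= b.+1)%N ->
  (p * q)`_(a + b) = p`_a * q`_b.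
Proof.
move=> pa qb; have aab : (a < (a + b).+1)%N by rewrite ltnS leq_addr.
rewrite coefM (bigD1 (Ordinal aab)) //= addKn big1 ?addr0 // => i ia.
have [i_a|a_i|ia'] := ltngtP i a.
- by rewrite [q`__]nth_default ?mulr0 // (leq_trans qb) // ltn_subRL ltn_add2r.
- by rewrite nth_default ?mul0r // (leq_trans pa).
- by case/eqP: ia; apply: val_inj.
Qed.

Lemma size_mul_top p q (a b : nat) : (size p <= a.+1)%N -> (size q <= b.+1)%N ->
  (size (p * q)%R <= (a + b).+1)%N.
Proof.
move=> pa qb; apply: (leq_trans (size_polyMleq _ _)).
have := leq_add pa qb; rewrite addSn addnS; by case: (size p + size q)%N.
Qed.

(** Any a bounding both degrees, with a nonzero coefficient of degree a in q, may replace
the degree of q; this makes the values at infinity stable under sums and products. *)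
Lemma ratval_infP x c : ratval x None c <-> exists p q (a : nat),
  [/\ x = p%:F / q%:F, q`_a != 0, (size q <= a.+1)%N, (size p <= a.+1)%N &
      c = p`_a / q`_a].
Proof.
split=> [[p [q [xE [q0 pq ->]]]]|[p [q [a [xE qa0 sq sp ->]]]]].
  have sq0 : (0 < size q)%N by rewrite size_poly_gt0.
  exists p, q, (size q).-1; rewrite prednK // -/(lead_coef q) lead_coef_eq0.
  by split.
have q0 : q != 0 by apply: contraNneq qa0 => ->; rewrite coef0.
have sqE : size q = a.+1.
  apply/eqP; rewrite eqn_leq sq /= ltnNge.
  by apply: contra qa0 => h; rewrite nth_default.
by exists p, q; split => //; rewrite /lead_coef sqE /= sp.
Qed.

Lemma ratval_uniq x s c c' : ratval x s c -> ratval x s c' -> c = c'.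
Proof.
case: s => [z /ratvalP[_ ->] /ratvalP[_ ->] //|].
move=> /ratval_infP[p [q [a [-> qa sq sp ->]]]].
move=> /ratval_infP[p' [q' [b [/eqP + qb sq' sp' ->]]]].
have q0 : q != 0 by apply: contraNneq qa => ->; rewrite coef0.
have q0' : q' != 0 by apply: contraNneq qb => ->; rewrite coef0.
rewrite quotient_eq // => /eqP E; apply/eqP; rewrite eqr_div //.
by rewrite -!coef_mul_top // E addnC.
Qed.

Lemma neq0_horner q (z : C) : q.[z] != 0 -> q != 0.
Proof. by apply: contraNneq => ->; rewrite horner0. Qed.
Lemma neq0_coef q (a : nat) : q`_a != 0 -> q != 0.
Proof. by apply: contraNneq => ->; rewrite coef0. Qed.

Lemma ratval_const s c : ratval (c%:P)%:F s c.
Proof.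
exists c%:P, 1; rewrite tofrac1 divr1; split => //.
case: s => [z|]; first by rewrite !hornerC oner_eq0 divr1.
by rewrite oner_eq0 size_poly1 size_polyC leq_b1 coefC lead_coef1 divr1.
Qed.
Lemma ratval0 s : ratval 0 s 0.
Proof. by have := ratval_const s 0; rewrite tofrac0. Qed.
Lemma ratval1 s : ratval 1 s 1.
Proof. by have := ratval_const s 1; rewrite tofrac1. Qed.

Lemma ratvalD x y s c d : ratval x s c -> ratval y s d -> ratval (x + y) s (c + d).
Proof.
case: s => [z|].
  move=> [p [q [-> [qz ->]]]] [p' [q' [-> [qz' ->]]]].
  exists (p * q' + p' * q), (q * q'); split.
    by rewrite tofracD !tofracM addf_div ?tofrac_eq0 ?(neq0_horner qz) ?(neq0_horner qz').
  by rewrite !hornerE mulf_neq0 // addf_div.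
move=> /ratval_infP[p [q [a [-> qa sq sp ->]]]].
move=> /ratval_infP[p' [q' [b [-> qb sq' sp' ->]]]].
apply/ratval_infP; exists (p * q' + p' * q), (q * q'), (a + b)%N; split.
- by rewrite tofracD !tofracM addf_div ?tofrac_eq0 ?(neq0_coef qa) ?(neq0_coef qb).
- by rewrite coef_mul_top // mulf_neq0.
- exact: size_mul_top.
- rewrite (leq_trans (size_polyD _ _)) // geq_max size_mul_top //=.
  by rewrite addnC size_mul_top.
- have E : (p' * q)`_(a + b) = p'`_b * q`_a by rewrite addnC coef_mul_top.
  by rewrite coefD E !coef_mul_top // addf_div.
Qed.

Lemma ratvalM x y s c d : ratval x s c -> ratval y s d -> ratval (x * y) s (c * d).
Proof.
case: s => [z|].
  move=> [p [q [-> [qz ->]]]] [p' [q' [-> [qz' ->]]]].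
  exists (p * p'), (q * q'); split; first by rewrite !tofracM mulf_div.
  by rewrite !hornerM mulf_neq0 // -mulf_div.
move=> /ratval_infP[p [q [a [-> qa sq sp ->]]]].
move=> /ratval_infP[p' [q' [b [-> qb sq' sp' ->]]]].
apply/ratval_infP; exists (p * p'), (q * q'), (a + b)%N; split.
- by rewrite !tofracM mulf_div.
- by rewrite coef_mul_top // mulf_neq0.
- exact: size_mul_top.
- exact: size_mul_top.
- by rewrite !coef_mul_top // mulf_div.
Qed.

Lemma ratvalN x s c : ratval x s c -> ratval (- x) s (- c).
Proof.
move=> H; rewrite -mulN1r -[- c]mulN1r; apply: ratvalM => //.
by have := ratval_const s (-1); rewrite polyCN tofracN tofrac1.
Qed.

Lemma ratvalV x s c : c != 0 -> ratval x s c -> ratval x^-1 s c^-1.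
Proof.
case: s => [z|] c0.
  move=> [p [q [-> [qz cE]]]]; exists q, p; rewrite !invf_div cE invf_div; split => //.
  by split => //; apply: contraNneq c0 => pz; rewrite cE pz mul0r.
move=> /ratval_infP[p [q [a [-> qa sq sp cE]]]].
apply/ratval_infP; exists q, p, a; rewrite cE !invf_div; split => //.
by apply: contraNneq c0 => pz; rewrite cE pz mul0r.
Qed.

Lemma ratval_sum I (r : seq I) (P : pred I) (F : I -> ratfun C) (G : I -> C) s :
  (forall i, P i -> ratval (F i) s (G i)) ->
  ratval (\sum_(i <- r | P i) F i) s (\sum_(i <- r | P i) G i).
Proof.
move=> H; elim/big_ind2: _ => //; first exact: ratval0.
by move=> x c y d; apply: ratvalD.
Qed.

Lemma ratval_prod I (r : seq I) (P : pred I) (F : I -> ratfun C) (G : I -> C) s :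
  (forall i, P i -> ratval (F i) s (G i)) ->
  ratval (\prod_(i <- r | P i) F i) s (\prod_(i <- r | P i) G i).
Proof.
move=> H; elim/big_ind2: _ => //; first exact: ratval1.
by move=> x c y d; apply: ratvalM.
Qed.

Lemma ratval_sign (b : bool) s : ratval ((-1) ^+ b) s ((-1) ^+ b).
Proof. by case: b; rewrite ?expr1 ?expr0; [apply: ratvalN|]; apply: ratval1. Qed.

Lemma mxratval_mul m (g h : 'M[ratfun C]_m) s A B :
  mxratval g s A -> mxratval h s B -> mxratval (g *m h) s (A *m B).
Proof. by move=> gA hB i j; rewrite !mxE; apply: ratval_sum => k _; apply: ratvalM. Qed.

Lemma mxratval1 m s : mxratval (1%:M : 'M[ratfun C]_m) s 1%:M.
Proof. by move=> i j; rewrite !mxE; case: (i == j); [apply: ratval1|apply: ratval0]. Qed.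

Lemma ratval_det m (g : 'M[ratfun C]_m) s A :
  mxratval g s A -> ratval (\det g) s (\det A).
Proof.
move=> gA; apply: ratval_sum => i _; apply: ratvalM; first exact: ratval_sign.
by apply: ratval_prod => j _; apply: gA.
Qed.

Lemma mxratval_adj m (g : 'M[ratfun C]_m) s A :
  mxratval g s A -> mxratval (\adj g) s (\adj A).
Proof.
move=> gA i j; rewrite !mxE /cofactor; apply: ratvalM; last first.
  by apply: ratval_det => k l; rewrite !mxE; apply: gA.
by rewrite -signr_odd -[X in ratval _ _ X]signr_odd; apply: ratval_sign.
Qed.

(** By the adjugate formula, since the determinant is a polynomial in the entries. *)
Lemma mxratval_inv m (g : 'M[ratfun C]_m) s A :
  mxratval g s A -> A \in unitmx ->
  g \in unitmx /\ mxratval (invmx g) s (invmx A).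
Proof.
move=> gA uA; have dA : \det A != 0 by rewrite -unitfE.
have ug : g \in unitmx.
  rewrite unitmxE unitfE; apply: contraNneq dA => dg0; apply/eqP.
  by apply: (ratval_uniq (s := s)) (ratval0 s); rewrite -dg0; apply: ratval_det.
split => // i j; rewrite /invmx uA ug !mxE.
apply: ratvalM; first by apply: ratvalV => //; apply: ratval_det.
by have := mxratval_adj gA i j; rewrite !mxE.
Qed.

Definition mxrateval m (g : 'M[ratfun C]_m) z : 'M[C]_m := \matrix_(i, j) rateval (g i j) z.
Definition common_den m (g : 'M[ratfun C]_m) : {poly C} := \prod_i \prod_j ratden (g i j).

Lemma common_den_neq0 m (g : 'M[ratfun C]_m) : common_den g != 0.
Proof. by apply/prodf_neq0 => i _; apply/prodf_neq0 => j _; apply: ratden_neq0. Qed.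

Lemma dvdp_bigprod (I : finType) (F : I -> {poly C}) i : F i %| \prod_j F j.
Proof. by rewrite (bigD1 i) // dvdp_mulIl. Qed.

Lemma ratden_dvd_common_den m (g : 'M[ratfun C]_m) i j : ratden (g i j) %| common_den g.
Proof.
apply: dvdp_trans (dvdp_bigprod (fun j => ratden (g i j)) j) _.
exact: (dvdp_bigprod (fun i => \prod_j ratden (g i j)) i).
Qed.

Lemma mxratvalP m (g : 'M[ratfun C]_m) z A :
  mxratval g (Some z) A <-> (common_den g).[z] != 0 /\ A = mxrateval g z.
Proof.
have E : (common_den g).[z] = \prod_i \prod_j (ratden (g i j)).[z].
  by rewrite /common_den horner_prod; apply: eq_bigr => i _; rewrite horner_prod.
rewrite E; split=> [gA|[/prodf_neq0 d0 ->] i j].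
  split; last by apply/matrixP => i j; rewrite mxE; have /ratvalP[] := gA i j.
  by apply/prodf_neq0 => i _; apply/prodf_neq0 => j _; have /ratvalP[] := gA i j.
by rewrite mxE; apply/ratvalP; split => //; move/prodf_neq0: (d0 i isT) => /(_ j isT).
Qed.

End RationalValues.

(** * Holomorphic matrices and the rational group *)

Section Holomorphy.
Local Open Scope sesquilinear_scope.
Variable R : realType.
Local Notation C := (CC R).
Implicit Types (z w : C) (D : set C).

Lemma cmod_conj z : cmod (z^*) = cmod z.
Proof. by apply: (@toC_inj R); rewrite -!CC_normE norm_conjC. Qed.

Lemma derivable_eps_delta (F : C -> C) z : derivable F z 1 ->
  forall e : R, 0 < e -> exists2 d : R, 0 < d & forall w, cmod (w - z) < d -> cmod (F w - F z) < e.
Proof.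
move=> /diff_at_derivable[l Fl] e e0; have [d d0 dH] := Fl _ (@ltr01 R).
have l0 : 0 < 1 + cmod l by rewrite ltr_pwDl // cmod_ge0.
exists (Num.min d (e / (1 + cmod l))); first by rewrite lt_min d0 divr_gt0.
move=> w; rewrite lt_min ltr_pdivlMr // => /andP[/dH {}dH we].
apply: le_lt_trans we.
have -> : F w - F z = (F w - F z - l * (w - z)) + l * (w - z) by ring.
by apply: le_trans (cmodD _ _) _; rewrite cmodM [leRHS]mulrDr mulr1 lerD //; [rewrite mul1r in dH|rewrite mulrC].
Qed.

Lemma derivable_conj (F : C -> C) z :
  derivable F z^* 1 -> derivable (fun w => (F w^*)^*) z 1.
Proof.
move=> /diff_at_derivable[l Fl]; apply/diff_at_derivable; exists l^* => e /Fl[d d0 dH].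
exists d => // w wz; have := dH w^*; rewrite -rmorphB cmod_conj => /(_ wz).
by rewrite -[X in X <= _]cmod_conj !rmorphB !rmorphM rmorphB /= !conjCK.
Qed.

Lemma avoid_finite (rs : seq C) z (d : R) : 0 < d ->
  exists2 t, 0 < t < d & z + toC t \notin rs.
Proof.
move=> d0; apply: contrapT => H.
pose u (k : nat) : C := z + toC (d / k.+2%:R).
have u_inj : injective u.
  move=> k l /addrI /toC_inj /(mulfI (lt0r_neq0 d0)) /invr_inj /eqP.
  by rewrite eqr_nat => /eqP[].
have : (size [seq u k | k <- iota 0 (size rs).+1] <= size rs)%N.
  apply: uniq_leq_size; first by rewrite map_inj_uniq // iota_uniq.
  move=> _ /mapP[k _ ->]; apply: contrapT => /negP uk; apply: H.
  exists (d / k.+2%:R) => //; rewrite divr_gt0 //=.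
  by rewrite gtr_pMr // invf_lt1 ?ltr1n.
by rewrite size_map size_iota ltnn.
Qed.

(** The inequality is only assumed at z + t for small t > 0 because z may be a boundary
point of the domain where it is known. *)
Lemma le_by_continuity (F G : C -> C) z (rs : seq C) (d : R) : 0 < d ->
  derivable F z 1 -> derivable G z 1 ->
  (forall t, 0 < t < d -> z + toC t \notin rs -> cmod (F (z + toC t)) <= cmod (G (z + toC t))) ->
  cmod (F z) <= cmod (G z).
Proof.
move=> d0 dF dG FG; rewrite leNgt; apply/negP => lt_GF.
pose e := (cmod (F z) - cmod (G z)) / 2.
have e0 : 0 < e by rewrite divr_gt0 // subr_gt0.
have [d1 d10 H1] := derivable_eps_delta dF e0.
have [d2 d20 H2] := derivable_eps_delta dG e0.
have dm : 0 < Num.min d (Num.min d1 d2) by rewrite !lt_min d0 d10.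
have [t /andP[t0]] := avoid_finite rs z dm.
rewrite !lt_min => /andP[td /andP[td1 td2]] trs.
have Nt : cmod (z + toC t - z) = t by rewrite addrC addKr cmod_toC gtr0_norm.
have {}H1 := H1 (z + toC t); rewrite Nt in H1; have {}H1 := H1 td1.
have {}H2 := H2 (z + toC t); rewrite Nt in H2; have {}H2 := H2 td2.
have h := FG t; rewrite t0 td in h; have {}h := h isT trs.
have h1 : cmod (F z) <= cmod (F (z + toC t)) + cmod (F (z + toC t) - F z).
  rewrite [cmod (_ - F z)]cmodB [leRHS]addrC.
  by have := cmodD (F z - F (z + toC t)) (F (z + toC t)); rewrite subrK.
have h2 : cmod (G (z + toC t)) <= cmod (G z) + cmod (G (z + toC t) - G z).
  by rewrite [leRHS]addrC; have := cmodD (G (z + toC t) - G z) (G z); rewrite subrK.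
by move: H1 H2 h h1 h2; rewrite /e; clear; lra.
Qed.

Lemma eq_by_continuity (F G : C -> C) z (rs : seq C) (d : R) : 0 < d ->
  derivable F z 1 -> derivable G z 1 ->
  (forall t, 0 < t < d -> z + toC t \notin rs -> F (z + toC t) = G (z + toC t)) ->
  F z = G z.
Proof.
move=> d0 dF dG FG; apply/eqP; rewrite -subr_eq0 -cmod_eq0 eq_le cmod_ge0 andbT.
have := @le_by_continuity (fun w => F w - G w) (fun=> 0) z rs d d0
  (derivable_sub dF dG) (@derivable_const _ 0 z); rewrite cmod0; apply=> t td trs.
by rewrite FG // subrr cmod0.
Qed.

Definition holomorphic_at n (A : C -> 'M[C]_n) z := forall i j, derivable (fun w => A w i j) z 1.

Section MatrixHolomorphy.
Variable n : nat.
Implicit Types (A B : C -> 'M[C]_n) (g h : 'M[ratfun C]_n).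

Lemma derivable_eq (F G : C -> C) z : F =1 G -> derivable F z 1 -> derivable G z 1.
Proof. by move=> /funext ->. Qed.

Lemma hol_const (a : 'M[C]_n) z : holomorphic_at (fun=> a) z.
Proof. by move=> i j; apply: derivable_const. Qed.

Lemma hol_mul A B z : holomorphic_at A z -> holomorphic_at B z -> holomorphic_at (fun w => A w *m B w) z.
Proof.
move=> dA dB i j; apply: (@derivable_eq (fun w => \sum_k A w i k * B w k j)).
  by move=> w; rewrite mxE.
by apply: derivable_bigsum => k; apply: derivable_mul.
Qed.

Lemma hol_add A B z : holomorphic_at A z -> holomorphic_at B z -> holomorphic_at (fun w => A w + B w) z.
Proof.
move=> dA dB i j; apply: (@derivable_eq (fun w => A w i j + B w i j)).
  by move=> w; rewrite mxE.
exact: derivable_add.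
Qed.

Lemma hol_scale (F : C -> C) A z : derivable F z 1 -> holomorphic_at A z -> holomorphic_at (fun w => F w *: A w) z.
Proof.
move=> dF dA i j; apply: (@derivable_eq (fun w => F w * A w i j)).
  by move=> w; rewrite mxE.
exact: (derivable_mul dF (dA i j)).
Qed.

Lemma hol_conj A z : holomorphic_at A z^* -> holomorphic_at (fun w => (A w^*)^t*) z.
Proof.
move=> dA i j; apply: (@derivable_eq (fun w => (A w^* j i)^*)).
  by move=> w; rewrite !mxE.
exact: (@derivable_conj (fun w => A w j i) z (dA j i)).
Qed.

Lemma derivable_poly (p : {poly C}) z : derivable (horner p) z 1.
Proof.
elim/poly_ind: p => [|p c IH].
  by apply: (@derivable_eq (fun=> 0)); [move=> w; rewrite horner0|apply: derivable_const].
apply: (@derivable_eq (fun w => p.[w] * w + c)); first by move=> w; rewrite !hornerE.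
have dM := derivable_mul IH (@derivable_var _ z).
have dc := @derivable_const _ c z.
exact (derivable_add dM dc).
Qed.

Lemma derivable_rateval (x : ratfun C) z : (ratden x).[z] != 0 -> derivable (rateval x) z 1.
Proof.
move=> dz; have dN := @derivable_poly (ratnum x) z.
have dV := @derivable_inv _ (horner (ratden x)) z dz (@derivable_poly (ratden x) z).
exact: (derivable_mul dN dV).
Qed.

Lemma hol_mxrateval g z : (common_den g).[z] != 0 -> holomorphic_at (mxrateval g) z.
Proof.
move=> gz i j; apply: (@derivable_eq (rateval (g i j))); first by move=> w; rewrite mxE.
apply: derivable_rateval.
have /mxratvalP/(_ i j)/ratvalP[] // : (common_den g).[z] != 0 /\ mxrateval g z = mxrateval g z by [].
Qed.

Lemma hol_eq A B z (rs : seq C) (d : R) : 0 < d -> holomorphic_at A z -> holomorphic_at B z ->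
  (forall t, 0 < t < d -> z + toC t \notin rs -> A (z + toC t) = B (z + toC t)) ->
  A z = B z.
Proof.
move=> d0 dA dB AB; apply/matrixP => i j.
apply: (eq_by_continuity (F := fun w => A w i j) (G := fun w => B w i j) (rs := rs) d0) => //.
by move=> t td trs; rewrite AB.
Qed.

Lemma nonroot_off_finite (p : {poly C}) : p != 0 -> exists rs : seq C, forall w, w \notin rs -> p.[w] != 0.
Proof.
move=> p0; have [rs pE] := closed_field_poly_normal p; exists rs => w wrs.
by rewrite pE hornerZ mulf_neq0 ?lead_coef_eq0 // -[_ != 0]/(~~ root _ _) root_prod_XsubC.
Qed.

Lemma regular_off_finite g : exists rs : seq C, forall w, w \notin rs ->
  (common_den g).[w] != 0 /\ (common_den g).[w^*] != 0.
Proof.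
have [rs rsP] := nonroot_off_finite (common_den_neq0 g).
exists (rs ++ map Num.conj rs) => w; rewrite mem_cat negb_or => /andP[wr wc].
split; apply: rsP => //; apply: contra wc => wr'.
by apply/mapP; exists w^*; rewrite ?conjCK.
Qed.

(** Off the poles both sides of the reality condition are continuous, so that it holds
wherever the values exist. *)
Lemma Gminus_off_finite g : mxratval g None 1%:M ->
  (exists rs : seq C, forall w, w \notin rs -> exists A B : 'M[C]_n,
    [/\ mxratval g (Some w) A, mxratval g (Some w^*) B & B^t* *m A = 1%:M]) ->
  Gminus g.
Proof.
move=> g1 [rs rsP]; split => //.
  apply: (@sub_finite_set _ _ [set` [seq Some w | w <- rs]]); last exact: finite_seq.
  move=> [w|] /= ns; last by case: ns; exists 1%:M; rewrite ?unitmx1.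
  apply/mapP; exists w => //; apply: contrapT => /negP /rsP[A [B [gA gB BA]]].
  by apply: ns; exists A => //; have /mulmx1_unit[] := BA.
move=> z A B /mxratvalP[gz ->] /mxratvalP[gz' ->].
apply: (hol_eq (A := fun w => (mxrateval g w^*)^t* *m mxrateval g w) (B := fun=> 1%:M) (rs := rs)
  (@ltr01 R)).
- by apply: hol_mul; [apply: hol_conj; apply: hol_mxrateval|apply: hol_mxrateval].
- exact: hol_const.
by move=> t _ /rsP[A' [B' [/mxratvalP[_ ->] /mxratvalP[_ ->]]]].
Qed.

Lemma Gminus_unitary g w : Gminus g -> (common_den g).[w] != 0 -> (common_den g).[w^*] != 0 ->
  (mxrateval g w^*)^t* *m mxrateval g w = 1%:M.
Proof. by case=> _ _ H gw gw'; apply: (H w); apply/mxratvalP. Qed.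

Lemma trmxC_mul (A B : 'M[C]_n) : (A *m B)^t* = B^t* *m A^t*.
Proof. by rewrite trmx_mul map_mxM. Qed.

Lemma unitary_mul (A A' B B' : 'M[C]_n) : A'^t* *m A = 1%:M -> B'^t* *m B = 1%:M ->
  (A' *m B')^t* *m (A *m B) = 1%:M.
Proof. by move=> hA hB; rewrite trmxC_mul -mulmxA (mulmxA (A'^t*)) hA mul1mx. Qed.

Lemma Gminus1 : Gminus (1%:M : 'M[ratfun C]_n).
Proof.
apply: Gminus_off_finite; first exact: mxratval1.
exists [::] => w _; exists 1%:M, 1%:M; split; try exact: mxratval1.
by rewrite trmx1 map_mx1 mul1mx.
Qed.

Lemma GminusM g h : Gminus g -> Gminus h -> Gminus (g *m h).
Proof.
move=> Gg Gh; apply: Gminus_off_finite.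
  have [_ g1 _] := Gg; have [_ h1 _] := Gh.
  by have := mxratval_mul g1 h1; rewrite mul1mx.
have [rs rsP] := regular_off_finite g; have [rs' rsP'] := regular_off_finite h.
exists (rs ++ rs') => w; rewrite mem_cat negb_or => /andP[/rsP[gw gw'] /rsP'[hw hw']].
exists (mxrateval g w *m mxrateval h w), (mxrateval g w^* *m mxrateval h w^*).
split; try by apply: mxratval_mul; apply/mxratvalP.
exact: unitary_mul (Gminus_unitary Gg gw gw') (Gminus_unitary Gh hw hw').
Qed.

End MatrixHolomorphy.
End Holomorphy.

(** * Uniqueness of dressing *)

Section Dressing.
Local Open Scope sesquilinear_scope.
Variable R : realType.
Local Notation C := (CC R).
Implicit Types (z w : C).

(** The properties of C and of the punctured plane that are used: in addition to being
open and symmetric, D misses only real points, each of which has a right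
neighbourhood on the real axis inside D. *)
Record symmetric_domain (D : set C) : Prop := SymmetricDomain {
  domain_open : forall z, D z -> exists2 d : R, 0 < d & forall w, cmod (w - z) < d -> D w;
  domain_conj : forall z, D z -> D z^*;
  domain_hole : forall z, ~ D z -> z^* = z /\
    exists2 d : R, 0 < d & forall t, 0 < t < d -> D (z + toC t) }.

Lemma domain_right (D : set C) : symmetric_domain D -> forall z,
  exists2 d : R, 0 < d & forall t, 0 < t < d -> D (z + toC t).
Proof.
move=> HD z; case: (pselect (D z)) => [/(domain_open HD)[d d0 dD]|/(domain_hole HD)[_]//].
exists d => // t /andP[t0 td]; apply: dD.
by rewrite addrC addKr cmod_toC gtr0_norm.
Qed.

Lemma setT_symmetric : symmetric_domain setT.
Proof.
by split=> [z _|z _|z /(_ I)//]; first exists 1.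
Qed.

Lemma punctured_symmetric : symmetric_domain [set~ 0].
Proof.
split=> z /=.
- move=> /eqP z0; exists (cmod z); first by rewrite cmod_gt0.
  by move=> w wz w0; move: wz; rewrite w0 sub0r cmodN ltxx.
- by move=> z0 /eqP; rewrite conjC_eq0 => /eqP.
move=> /contrapT ->; rewrite rmorph0; split => //; exists 1 => // t /andP[t0 _].
by rewrite add0r => /eqP; rewrite -cmod_eq0 cmod_toC normr_eq0 gt_eqF.
Qed.

Section Domain.
Variables (n : nat) (D : set C).
Hypothesis HD : symmetric_domain D.
Implicit Types (f : C -> 'M[C]_n) (g h : 'M[ratfun C]_n).

Lemma hol_eq_domain (A B : C -> 'M[C]_n) z (rs : seq C) : holomorphic_at A z -> holomorphic_at B z ->
  (forall w, D w -> w \notin rs -> A w = B w) -> A z = B z.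
Proof.
move=> dA dB AB; have [d d0 dD] := domain_right HD z.
by apply: (hol_eq (rs := rs) d0) => // t td trs; apply: AB => //; apply: dD.
Qed.

Lemma Gplus_hol f z : Gplus D f -> D z -> holomorphic_at f z.
Proof. by move=> [hf _ _] Dz i j; apply: hf. Qed.

Lemma Gplus_unitary f z : Gplus D f -> D z -> (f z^*)^t* *m f z = 1%:M.
Proof. by move=> [_ _ H] Dz; apply: H => //; apply: domain_conj. Qed.

Lemma Gplus_unitary' f z : Gplus D f -> D z -> f z *m (f z^*)^t* = 1%:M.
Proof. by move=> Gf Dz; apply: mulmx1C; apply: Gplus_unitary. Qed.

Lemma dressing_rateval g f f' : dressing D g f f' -> Gplus D f' ->
  exists2 h, Gminus h & forall z, D z -> (common_den g).[z] != 0 -> (common_den h).[z] != 0 ->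
    mxrateval g z *m f z = f' z *m mxrateval h z.
Proof.
move=> [h Gh H] Gf'; exists h => // z Dz gz hz.
have [_ uf' _] := Gf'.
have /mxratvalP vg := conj gz (erefl (mxrateval g z)).
have /mxratvalP vh := conj hz (erefl (mxrateval h z)).
by rewrite -(H z _ _ Dz vg vh) -mulmxA mulKVmx // uf'.
Qed.

(** Both sides of g f = f' h are continuous where g and h have values. *)
Lemma dressing_off_finite g h f f' (rs : seq C) : Gplus D f -> Gplus D f' -> Gminus h ->
  (forall z, D z -> z \notin rs -> mxrateval g z *m f z = f' z *m mxrateval h z) ->
  dressing D g f f'.
Proof.
move=> Gf Gf' Gh H; exists h => // z A B Dz /mxratvalP[gz ->] /mxratvalP[hz ->].
have [_ uf' _] := Gf'.
have -> : invmx (f' z) *m mxrateval g z *m f z = invmx (f' z) *m (mxrateval g z *m f z).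
  by rewrite mulmxA.
suff -> : mxrateval g z *m f z = f' z *m mxrateval h z by rewrite mulmxA mulVmx ?uf' // mul1mx.
apply: (hol_eq_domain (A := fun w => mxrateval g w *m f w) (B := fun w => f' w *m mxrateval h w) (rs := rs)) => //.
  by apply: hol_mul; [apply: hol_mxrateval|apply: Gplus_hol].
by apply: hol_mul; [apply: Gplus_hol|apply: hol_mxrateval].
Qed.

Lemma unitary_entry_le1 (U : 'M[C]_n) i j : U^t* *m U = 1%:M -> cmod (U i j) <= 1.
Proof.
move=> /matrixP/(_ j j); rewrite !mxE eqxx mulr1n (bigD1 i) //= !mxE => E.
have ge0 k : 0 <= (U^t*) j k * U k j by rewrite !mxE mulrC mul_conjC_ge0.
have : `|U i j| ^+ 2 <= 1.
  by rewrite normCK mulrC -E lerDl sumr_ge0.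
by rewrite CC_normE -(rmorph1 (@toC R)) -rmorphXn /= toC_le -[X in _ <= X](expr1n _ 2) ler_sqr ?nnegrE ?cmod_ge0.
Qed.

(** The denominator has no root in an algebraically closed field, so it is constant,
and the value at infinity bounds the degree of the numerator by 0. *)
Lemma polefree_const (x : ratfun C) (c : C) : (forall z, (ratden x).[z] != 0) ->
  ratval x None c -> x = (c%:P)%:F.
Proof.
move=> dx /[dup] xc /ratval_infP[p [q [a [xE qa sq sp _]]]].
have q0 := neq0_coef qa.
have sqE : size q = a.+1.
  apply/eqP; rewrite eqn_leq sq /= ltnNge.
  by apply: contra qa => h; rewrite nth_default.
have sd : size (ratden x) == 1%N.
  by apply/negPn/negP => /closed_rootP[z]; rewrite /root (negPf (dx z)).
have /size_poly1P[e e0 dE] := sd.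
have E : p * ratden x = ratnum x * q.
  by apply/eqP; rewrite eq_sym -quotient_eq ?ratden_neq0 // -ratnum_denE -xE eqxx.
have sn : (size (ratnum x) <= 1)%N.
  have [->|n0] := eqVneq (ratnum x) 0; first by rewrite size_poly0.
  have : (size (ratnum x * q)%R <= a.+1)%N.
    by rewrite -E dE mulrC mul_polyC (leq_trans (size_scale_leq _ _)).
  by rewrite size_mul // sqE addnS /= addnC -[X in (_ <= X)%N]addn1 leq_add2l.
have nE := size1_polyC sn.
have xE' : x = ((ratnum x)`_0 / e)%:P%:F.
  rewrite -[RHS]divr1 -tofrac1 {1}[x]ratnum_denE; apply/eqP.
  by rewrite quotient_eq ?oner_eq0 ?ratden_neq0 // dE {1}nE mulr1 -polyCM divfK.
rewrite xE'; congr ((_)%:P)%:F; apply: (ratval_uniq (s := None)) xc.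
by rewrite {1}xE'; apply: ratval_const.
Qed.

(** With m = h2 h1^-1, the matrix X = f2^-1 f1 is holomorphic on D and m = X off a finite
set; it suffices that the entries of m have no poles ([polefree_const]). *)
Lemma dressing_unique g f f1 f2 : Gminus g -> Gplus D f -> Gplus D f1 -> Gplus D f2 ->
  dressing D g f f1 -> dressing D g f f2 -> forall z, D z -> f1 z = f2 z.
Proof.
move=> Gg Gf G1 G2 /dressing_rateval/(_ G1)[h1 Gh1 E1] /dressing_rateval/(_ G2)[h2 Gh2 E2].
pose X w := (f2 w^*)^t* *m f1 w.
have holX w : D w -> holomorphic_at X w.
  move=> Dw; apply: hol_mul; last exact: Gplus_hol.
  by apply: hol_conj; apply: Gplus_hol => //; apply: domain_conj.
suff X1 : forall w, D w -> X w = 1%:M.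
  move=> z Dz; have := congr1 (mulmx (f2 z)) (X1 z Dz).
  by rewrite mulmxA Gplus_unitary' // mul1mx mulmx1.
have [_ h11 _] := Gh1; have [_ h21 _] := Gh2.
pose m := h2 *m invmx h1.
have m1 : mxratval m None 1%:M.
  have [_ hV] := mxratval_inv h11 (unitmx1 _ _).
  by have := mxratval_mul h21 hV; rewrite invmx1 mulmx1.
have [rs0 r0P] := regular_off_finite g.
have [rs1 r1P] := regular_off_finite h1; have [rs2 r2P] := regular_off_finite h2.
pose rs := rs0 ++ rs1 ++ rs2.
have mX w : D w -> w \notin rs -> (common_den m).[w] != 0 /\ mxrateval m w = X w.
  move=> Dw; rewrite !mem_cat !negb_or => /and3P[/r0P[gw gw'] /r1P[hw1 hw1'] /r2P[hw2 hw2']].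
  have /mulmx1_unit[_ u1] := Gminus_unitary Gh1 hw1 hw1'.
  have /mxratvalP v1 := conj hw1 (erefl (mxrateval h1 w)).
  have /mxratvalP v2 := conj hw2 (erefl (mxrateval h2 w)).
  have [_ v1'] := mxratval_inv v1 u1.
  have /mxratvalP[mw <-] := mxratval_mul v2 v1'; split => //.
  apply: (canLR (mulmxK u1)); rewrite /X; rewrite -mulmxA -(E1 w) // (E2 w) // mulmxA.
  by rewrite Gplus_unitary // mul1mx.
have entry i j w : D w -> w \notin rs -> (ratnum (m i j)).[w] = X w i j * (ratden (m i j)).[w].
  move=> Dw wrs; have [pm <-] := mX w Dw wrs.
  have /mxratvalP mw := conj pm (erefl (mxrateval m w)).
  have /ratvalP[dw _] := mw i j.
  by rewrite [mxrateval m w i j]mxE /rateval divfK.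
have no_pole i j z : (ratden (m i j)).[z] != 0.
  apply/negP => dz; suff nz : (ratnum (m i j)).[z] = 0.
    have := coprimep_root (coprime_ratnum_den (m i j)); rewrite /root => /(_ z).
    by rewrite nz eqxx => /(_ isT); rewrite (eqP dz) eqxx.
  have [d d0 dD] := domain_right HD z.
  case: (pselect (D z)) => Dz.
    have -> : (ratnum (m i j)).[z] = X z i j * (ratden (m i j)).[z].
      apply: (eq_by_continuity (F := horner (ratnum (m i j)))
        (G := fun w => X w i j * (ratden (m i j)).[w]) (rs := rs) d0).
      - exact: derivable_poly.
      - exact: (derivable_mul (holX z Dz i j) (@derivable_poly _ (ratden (m i j)) z)).
      by move=> t td; apply: entry; apply: dD.
    by rewrite (eqP dz) mulr0.
  (* Near a point z outside D, the entries are bounded by 1 on the real axis. *)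
  have [zr _] := domain_hole HD Dz.
  have : cmod (ratnum (m i j)).[z] <= cmod (ratden (m i j)).[z].
    apply: (le_by_continuity (F := horner (ratnum (m i j)))
      (G := horner (ratden (m i j))) (rs := rs) d0); try exact: derivable_poly.
    move=> t td trs; have Dt := dD t td.
    have tr : (z + toC t)^* = z + toC t.
      rewrite rmorphD /= zr; congr (_ + _); exact: conjc_real.
    rewrite entry // cmodM; apply: (ler_piMl (cmod_ge0 _)).
    apply: (@unitary_entry_le1 (X (z + toC t))).
    have V1 := Gplus_unitary G1 Dt; have V2 := Gplus_unitary' G2 Dt.
    rewrite /X; rewrite !tr in V1 V2 *.
    rewrite trmxC_mul trmxCK -mulmxA (mulmxA (f2 _)) V2 mul1mx; exact: V1.
  by rewrite (eqP dz) cmod0 => n0; apply/eqP; rewrite -cmod_eq0 eq_le n0 cmod_ge0.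
have mE : m = 1%:M.
  apply/matrixP => i j; rewrite (polefree_const (no_pole i j) (m1 i j)) !mxE.
  by case: (i == j); rewrite ?tofrac1 ?tofrac0.
move=> w Dw; apply: (hol_eq_domain (A := X) (B := fun=> 1%:M) (rs := rs)).
- exact: holX.
- exact: hol_const.
move=> v Dv vrs; have [_ <-] := mX v Dv vrs; rewrite mE.
by have /mxratvalP[_ <-] := @mxratval1 C n (Some v).
Qed.

End Domain.
End Dressing.

(** * Simple elements *)

Section SimpleElements.
Local Open Scope sesquilinear_scope.
Variables (R : realType) (n : nat).
Local Notation C := (CC R).
Implicit Types (A P M : 'M[C]_n) (a z w : C).

(** P is the orthogonal projection onto the row space of A.  Its rows lie in this
space, so P = Y A for some Y and P = P^* = A^* Y^*; hence M A^* = 0 implies M P = 0. *)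
Lemma orthogonal_projection A : exists P, [/\ P^t* = P, P *m P = P, A *m P = A &
  forall M, M *m A^t* = 0 -> M *m P = 0].
Proof.
pose P : 'M[C]_n := proj_ortho A.
have /submxP[Y PE] : (P <= A)%MS by have := proj_ortho_sub A 1%:M; rewrite mul1mx.
have orth : (1%:M - P) *m A^t* = 0.
  by apply/orthomx1P; have := proj_ortho_compl_sub A 1%:M; rewrite mul1mx.
have PPt : P^t* = P *m P^t*.
  apply/eqP; rewrite -subr_eq0 -{1}[P^t*]mul1mx -mulmxBl.
  by rewrite {2}PE trmxC_mul mulmxA orth mul0mx.
have herm : P^t* = P.
  by rewrite -[RHS](@trmxCK C n n) {2}PPt trmxC_mul trmxCK -PPt.
exists P; split => //; first exact: proj_ortho_proj.
  by apply: proj_ortho_id; apply: submx_refl.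
by move=> M MA; rewrite -herm PE trmxC_mul mulmxA MA mul0mx.
Qed.

(** The rational matrix (I - P) + (X - a) / (X - conj a) P; exchanging a and
conj a inverts it when P is a projection. *)
Definition simple_element a P : 'M[ratfun C]_n :=
  \matrix_(i, j) (((1%:M - P) i j)%:P%:F +
    ('X - a%:P)%:F / ('X - (a^*)%:P)%:F * (P i j)%:P%:F).

Definition simple_value a P w : 'M[C]_n := (1%:M - P) + ((w - a) / (w - a^*)) *: P.

Lemma simple_valueP a P w : w != a^* -> mxratval (simple_element a P) (Some w) (simple_value a P w).
Proof.
move=> wa i j; rewrite [simple_element a P i j]mxE [simple_value a P w i j]mxE [(_ *: P) i j]mxE.
apply: ratvalD; first exact: ratval_const.
apply: ratvalM; last exact: ratval_const.
by exists ('X - a%:P), ('X - (a^*)%:P); rewrite !hornerXsubC subr_eq0.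
Qed.

Lemma simple_element_inf a P : mxratval (simple_element a P) None 1%:M.
Proof.
move=> i j; have -> : (1%:M : 'M[C]_n) i j = (1%:M - P) i j + 1 * P i j.
  by rewrite !mxE mul1r subrK.
rewrite [simple_element a P i j]mxE.
apply: ratvalD; first exact: ratval_const.
apply: ratvalM; last exact: ratval_const.
exists ('X - a%:P), ('X - (a^*)%:P); split => //.
rewrite polyXsubC_eq0 !size_XsubC lead_coefXsubC /=; split => //.
by rewrite coefB coefX coefC subr0 divr1.
Qed.

Lemma simple_value_mul a P w : P *m P = P -> w != a -> w != a^* ->
  simple_value a P w *m simple_value a^* P w = 1%:M.
Proof.
move=> PP wa wa'; rewrite /simple_value conjCK.
have QP : (1%:M - P) *m P = 0 by rewrite mulmxBl mul1mx PP subrr.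
have PQ : P *m (1%:M - P) = 0 by rewrite mulmxBr mulmx1 PP subrr.
have QQ : (1%:M - P) *m (1%:M - P) = 1%:M - P by rewrite mulmxBr mulmx1 QP subr0.
have := subrK P 1%:M; move: QP PQ QQ; move: (1%:M - P) => Q QP PQ QQ QD.
rewrite mulmxDl !mulmxDr QQ -!scalemxAl -!scalemxAr QP PQ !scaler0 PP add0r addr0.
by rewrite scalerA mulf_div [X in _ / X]mulrC divff ?scale1r // mulf_neq0 // subr_eq0.
Qed.

Lemma simple_value_conj a P w : P^t* = P -> (simple_value a P w^*)^t* = simple_value a^* P w.
Proof.
move=> Pt; rewrite /simple_value conjCK linearD /= map_mxD linearB /= map_mxB Pt.
rewrite trmx1 map_mx1 linearZ /= map_mxZ Pt; congr (_ + _ *: _).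
by rewrite rmorphM fmorphV !rmorphB /= !conjCK.
Qed.

Lemma Gminus_simple a P : P^t* = P -> P *m P = P -> Gminus (simple_element a P).
Proof.
move=> Pt PP; apply: Gminus_off_finite; first exact: simple_element_inf.
exists [:: a; a^*] => w; rewrite !inE negb_or => /andP[wa wa'].
exists (simple_value a P w), (simple_value a P w^*); split.
- exact: simple_valueP.
- by apply: simple_valueP; rewrite (can_eq (@conjCK C)).
by rewrite simple_value_conj //; apply: mulmx1C; apply: simple_value_mul.
Qed.

End SimpleElements.

(** * Existence of dressing *)

Section Existence.
Local Open Scope sesquilinear_scope.
Variables (R : realType) (n : nat).
Local Notation C := (CC R).
Variable D : set C.
Hypothesis HD : symmetric_domain D.
Implicit Types (f G : C -> 'M[C]_n) (g h : 'M[ratfun C]_n) (z w a : C).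

(** [removable_singularity], entry by entry. *)
Lemma divide_hol G a : (forall z, D z -> holomorphic_at G z) -> (D a -> G a = 0) ->
  exists2 V, forall z, D z -> holomorphic_at V z & forall z, D z -> G z = (z - a) *: V z.
Proof.
move=> holG Ga.
have /choice[v vP] : forall ij : 'I_n * 'I_n, exists v : C -> C,
    (forall z, D z -> derivable v z 1) /\
    forall z, D z -> G z ij.1 ij.2 = (z - a) * v z.
  move=> [i j] /=.
  have [||v dv vE] := @removable_singularity R D (fun w => G w i j) a (domain_open HD).
  - by move=> z Dz; apply: holG.
  - by move=> /Ga ->; rewrite mxE.
  by exists v.
exists (fun z => \matrix_(i, j) v (i, j) z) => z Dz.
  move=> i j; apply: (@derivable_eq R (v (i, j))); first by move=> w; rewrite mxE.
  by have [+ _] := vP (i, j); apply.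
by apply/matrixP => i j; rewrite !mxE; have [_ ->] := vP (i, j).
Qed.

Definition root_poly (rs : seq C) : {poly C} := \prod_(a <- rs) ('X - a%:P).

(** G is q f' h, with q the polynomial of roots rs.  The reality condition of G is put
in the form G(z) G(conj z)^* because the value at conj a must kill the image of
G(a)^*. *)
Lemma factorization (rs : seq C) G : (forall z, D z -> holomorphic_at G z) ->
  (forall z, D z -> G z *m (G z^*)^t* =
     ((root_poly rs).[z] * ((root_poly rs).[z^*])^*) *: 1%:M) ->
  exists f' h (bad : seq C), [/\ Gplus D f', Gminus h &
    forall z, D z -> z \notin bad ->
      (common_den h).[z] != 0 /\ G z = (root_poly rs).[z] *: (f' z *m mxrateval h z)].
Proof.
elim: rs G => [|a rs IH] G holG GG.
  have {}GG z : D z -> G z *m (G z^*)^t* = 1%:M.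
    by move=> Dz; rewrite GG // /root_poly big_nil !hornerC rmorph1 mulr1 scale1r.
  exists G, 1%:M, [::]; split; last 1 first.
  - move=> z Dz _; have /mxratvalP[p1 <-] := @mxratval1 C n (Some z).
    by rewrite /root_poly big_nil hornerC scale1r mulmx1.
  - split; first by move=> i j z Dz; apply: holG.
      by move=> z /GG/mulmx1_unit[].
    by move=> z Dz _; apply: mulmx1C; apply: GG.
  - exact: Gminus1.
have qE w : (root_poly (a :: rs)).[w] = (w - a) * (root_poly rs).[w].
  by rewrite /root_poly big_cons hornerM hornerXsubC.
have [P [Pt PP AP PM]] := orthogonal_projection (G a).
have [||V1 holV1 V1E] := @divide_hol (fun w => G w *m (1%:M - P)) a.
- by move=> z Dz; apply: hol_mul; [apply: holG|apply: hol_const].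
- by move=> _; rewrite mulmxBr mulmx1 AP subrr.
have [||V2 holV2 V2E] := @divide_hol (fun w => G w *m P) a^*.
- by move=> z Dz; apply: hol_mul; [apply: holG|apply: hol_const].
- move=> Da; apply: PM; have := GG _ Da.
  by rewrite conjCK => ->; rewrite [X in _ * X^*]qE subrr mul0r rmorph0 mulr0 scale0r.
(* G1 = G s / (z - a), written so that it makes sense at a and at conj a. *)
pose G1 w := V1 w + V2 w.
have holG1 z : D z -> holomorphic_at G1 z.
  by move=> Dz; apply: hol_add; [apply: holV1|apply: holV2].
have G1E z : D z -> z != a^* -> (z - a) *: G1 z = G z *m simple_value a P z.
  move=> Dz za; rewrite scalerDr -V1E // /simple_value [RHS]mulmxDr -scalemxAr V2E // scalerA.
  by rewrite divfK // subr_eq0.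
have G1G1 z : D z -> G1 z *m (G1 z^*)^t* =
    ((root_poly rs).[z] * ((root_poly rs).[z^*])^*) *: 1%:M.
  move=> Dz; apply: (hol_eq_domain HD (A := fun w => G1 w *m (G1 w^*)^t*)
    (B := fun w => ((root_poly rs).[w] * ((root_poly rs).[w^*])^*) *: 1%:M)
    (rs := [:: a; a^*])).
  - apply: hol_mul; first exact: holG1.
    by apply: hol_conj; apply: holG1; apply: domain_conj.
  - apply: hol_scale; last exact: hol_const.
    exact: (derivable_mul (@derivable_poly _ _ z)
      (@derivable_conj R (horner (root_poly rs)) z (@derivable_poly _ _ _))).
  move=> w Dw; rewrite !inE negb_or => /andP[wa wa'].
  have Dw' := domain_conj HD Dw.
  have wc : w^* != a^* by rewrite (can_eq (@conjCK C)).
  have c0 : (w - a) * (w^* - a)^* != 0.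
    rewrite mulf_neq0 ?subr_eq0 // conjC_eq0 subr_eq0.
    by apply: contra wa' => /eqP <-; rewrite conjCK.
  apply: (scalerI c0); rewrite scalerA mulrACA -rmorphM -!qE -GG //.
  rewrite -scalerA scalemxAr scalemxAl.
  have -> : (w^* - a)^* *: (G1 w^*)^t* = ((w^* - a) *: G1 w^*)^t*.
    by rewrite linearZ /= map_mxZ.
  rewrite !G1E // trmxC_mul simple_value_conj // -mulmxA (mulmxA (simple_value a P w)).
  by rewrite simple_value_mul // mul1mx.
have [f' [h1 [bad [Gf' Gh1 H]]]] := IH G1 holG1 G1G1.
exists f', (h1 *m simple_element a^* P), [:: a, a^* & bad]; split => //.
  by apply: GminusM => //; apply: Gminus_simple.
move=> z Dz; rewrite !inE !negb_or => /and3P[za za' zbad].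
have [p1 G1z] := H z Dz zbad.
have /mxratvalP v1 := conj p1 (erefl (mxrateval h1 z)).
have v2 : mxratval (simple_element a^* P) (Some z) (simple_value a^* P z).
  by apply: simple_valueP; rewrite conjCK.
have /mxratvalP[ph <-] := mxratval_mul v1 v2; split; first exact: ph.
rewrite qE -scalerA mulmxA scalemxAl -G1z scalemxAl G1E // -mulmxA.
by rewrite simple_value_mul // mulmx1.
Qed.

(** Multiplying g by a common denominator, made monic to be a product of linear
factors, gives the holomorphic matrix G to which [factorization] applies. *)
Lemma dressing_exists g f : Gminus g -> Gplus D f ->
  exists2 f', Gplus D f' & dressing D g f f'.
Proof.
move=> Gg Gf.
pose b := common_den g.
pose Pm (w : C) : 'M[C]_n := \matrix_(i, j) (ratnum (g i j) * (b %/ ratden (g i j))).[w].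
have den_b i j : ratden (g i j) %| b := ratden_dvd_common_den g i j.
have PmE w : b.[w] != 0 -> Pm w = b.[w] *: mxrateval g w.
  move=> bw; apply/matrixP => i j; rewrite !mxE /rateval hornerM.
  have dw : (ratden (g i j)).[w] != 0.
    have /mxratvalP/(_ i j)/ratvalP[] // := conj bw (erefl (mxrateval g w)).
  by rewrite -{2}(divpK (den_b i j)) hornerM; field.
have b0 := common_den_neq0 g.
have [rs bE] := closed_field_poly_normal b.
pose c := lead_coef b; have c0 : c != 0 by rewrite lead_coef_eq0.
have bqE w : b.[w] = c * (root_poly rs).[w] by rewrite {1}bE hornerZ.
pose G w := c^-1 *: (Pm w *m f w).
have GE w : b.[w] != 0 -> G w = (root_poly rs).[w] *: (mxrateval g w *m f w).
  move=> bw; rewrite /G (PmE w bw) -scalemxAl scalerA; congr (_ *: _).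
  by rewrite bqE mulrA mulVf // mul1r.
have holG z : D z -> holomorphic_at G z.
  move=> Dz; apply: hol_scale; first exact: derivable_const.
  apply: hol_mul; last exact: Gplus_hol Gf Dz.
  move=> i j; apply: (@derivable_eq R (horner (ratnum (g i j) * (b %/ ratden (g i j))))).
    by move=> w; rewrite mxE.
  exact: derivable_poly.
have [rs0 r0P] := regular_off_finite g.
have GG z : D z -> G z *m (G z^*)^t* =
     ((root_poly rs).[z] * ((root_poly rs).[z^*])^*) *: 1%:M.
  move=> Dz; apply: (hol_eq_domain HD (A := fun w => G w *m (G w^*)^t*)
    (B := fun w => ((root_poly rs).[w] * ((root_poly rs).[w^*])^*) *: 1%:M)
    (rs := rs0)).
  - apply: hol_mul; first exact: holG.
    by apply: hol_conj; apply: holG; apply: domain_conj.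
  - apply: hol_scale; last exact: hol_const.
    exact: (derivable_mul (@derivable_poly _ _ z)
      (@derivable_conj R (horner (root_poly rs)) z (@derivable_poly _ _ _))).
  move=> w Dw /r0P[gw gw'].
  have Ug := mulmx1C (Gminus_unitary Gg gw gw').
  have Uf := Gplus_unitary' HD Gf Dw.
  rewrite !GE // linearZ /= map_mxZ -scalemxAl -scalemxAr scalerA; congr (_ *: _).
  by rewrite trmxC_mul -mulmxA (mulmxA (f w)) Uf mul1mx.
have [f' [h [bad [Gf' Gh H]]]] := factorization holG GG.
exists f' => //; apply: (dressing_off_finite HD (rs := rs0 ++ bad)) Gf Gf' Gh _ => z Dz.
rewrite mem_cat negb_or => /andP[/r0P[gz _] zbad].
have [_] := H z Dz zbad; rewrite GE // => /scalerI; apply.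
by move: gz; rewrite -/b bqE; apply: contraNneq => ->; rewrite mulr0.
Qed.

Lemma mxrateval_mul g h w : (common_den g).[w] != 0 -> (common_den h).[w] != 0 ->
  mxrateval (g *m h) w = mxrateval g w *m mxrateval h w.
Proof.
move=> gw hw; have /mxratvalP vg := conj gw (erefl (mxrateval g w)).
have /mxratvalP vh := conj hw (erefl (mxrateval h w)).
by have /mxratvalP[_ <-] := mxratval_mul vg vh.
Qed.

Lemma mulmx_chain (A B F F1 F2 K1 K2 : 'M[C]_n) :
  B *m F = F1 *m K1 -> A *m F1 = F2 *m K2 -> A *m B *m F = F2 *m (K2 *m K1).
Proof. by move=> h1 h2; rewrite -mulmxA h1 mulmxA h2 mulmxA. Qed.

Lemma dressing_comp g h f f1 f2 : Gminus g -> Gminus h ->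
  Gplus D f -> Gplus D f1 -> Gplus D f2 ->
  dressing D h f f1 -> dressing D g f1 f2 -> dressing D (g *m h) f f2.
Proof.
move=> Gg Gh Gf G1 G2 /dressing_rateval/(_ G1)[k1 Gk1 E1] /dressing_rateval/(_ G2)[k2 Gk2 E2].
have [rsg rgP] := regular_off_finite g; have [rsh rhP] := regular_off_finite h.
have [rs1 r1P] := regular_off_finite k1; have [rs2 r2P] := regular_off_finite k2.
apply: (dressing_off_finite HD (rs := rsg ++ rsh ++ rs1 ++ rs2)) Gf G2 (GminusM Gk2 Gk1) _.
move=> z Dz; rewrite !mem_cat !negb_or.
move=> /and4P[/rgP[gz _] /rhP[hz _] /r1P[k1z _] /r2P[k2z _]].
have Egh := mxrateval_mul gz hz; have Ek := mxrateval_mul k2z k1z.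
rewrite Egh Ek; exact: mulmx_chain (E1 z Dz hz k1z) (E2 z Dz gz k2z).
Qed.

Lemma dressing_one f : Gplus D f -> dressing D 1%:M f f.
Proof.
move=> Gf; apply: (dressing_off_finite HD (rs := [::]) Gf Gf (Gminus1 R n)) => z _ _.
by have /mxratvalP[_ <-] := @mxratval1 C n (Some z); rewrite mul1mx mulmx1.
Qed.

Lemma dressing_action_exists :
  exists sharp : 'M[ratfun C]_n -> (C -> 'M[C]_n) -> (C -> 'M[C]_n),
    dressing_action D sharp.
Proof.
have /choice[s sP] : forall gf : 'M[ratfun C]_n * (C -> 'M[C]_n), exists f',
    Gminus gf.1 -> Gplus D gf.2 -> Gplus D f' /\ dressing D gf.1 gf.2 f'.
  move=> [g f] /=; case: (pselect (Gminus g /\ Gplus D f)) => [[Gg Gf]|nG].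
    by have [f' Gf' df'] := dressing_exists Gg Gf; exists f'.
  by exists f => Gg Gf; case: nG.
have {}sP g f := sP (g, f); simpl in sP.
exists (fun g f => s (g, f)); split => //.
- move=> g f f' Gg Gf Gf' df' z Dz; have [Gs ds] := sP g f Gg Gf.
  exact: (dressing_unique HD Gg Gf Gf' Gs df' ds).
- move=> f Gf z Dz; have [Gs ds] := sP _ f (Gminus1 R n) Gf.
  exact: (dressing_unique HD (Gminus1 R n) Gf Gs Gf ds (dressing_one Gf)).
move=> g h f Gg Gh Gf z Dz; have [G1 d1] := sP h f Gh Gf.
have [G2 d2] := sP g _ Gg G1; have Ggh := GminusM Gg Gh.
have [G3 d3] := sP _ f Ggh Gf.
exact: (dressing_unique HD Ggh Gf G3 G2 d3 (dressing_comp Gg Gh Gf G1 G2 d1 d2)).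
Qed.

End Existence.

Theorem mainTheorem4 (R : realType) (n : nat) :
  let C : numClosedFieldType := R[i] in
  (exists sharp : 'M[ratfun C]_n -> (C -> 'M[C]_n) -> (C -> 'M[C]_n),
     dressing_action setT sharp) /\
  (exists sharp : 'M[ratfun C]_n -> (C -> 'M[C]_n) -> (C -> 'M[C]_n),
     dressing_action [set~ 0] sharp).
Proof.
split.
  exact: (dressing_action_exists n (setT_symmetric R)).
exact: (dressing_action_exists n (punctured_symmetric R)).
Qed.
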